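(* There is a polynomial-time algorithm which, given a graph $G$ in $\mathrm{Free}(\text{claw}, 4K_1, \text{5-wheel}, C_5\text{-twin}, P_5\text{-twin}, K_5-e)$, computes the chromatic number $\chi(G)$.
   Context: For a set $L$ of graphs, $\mathrm{Free}(L)$ is the class of graphs containing no induced subgraph isomorphic to a member of $L$. The claw is $K_{1,3}$. $4K_1$ is the edgeless graph on four vertices. The 5-wheel is the graph obtained from the cycle $C_5$ by adding one vertex adjacent to all five cycle vertices. The $C_5$-twin is the 6-vertex graph obtained from a cycle $C_5$ by adding a new vertex adjacent to one cycle vertex $v$ and to both neighbours of $v$ on the cycle (a true twin of $v$). The $P_5$-twin is the 6-vertex graph obtained from a path $p_1p_2p_3p_4p_5$ by adding a new vertex adjacent to exactly $p_2,p_3,p_4$ (a true twin of the middle vertex). $K_5-e$ is the complete graph on five vertices with one edge removed. *)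

(* Defs.v *)
From mathcomp Require Import all_boot.
Unset Printing Implicit Defensive.

(* A finite simple graph on vertex set 'I_n is a symmetric irreflexive
   relation e : rel 'I_n (checked by hypotheses in the theorem). *)

Definition mk_graph (m : nat) (es : seq (nat * nat)) : rel 'I_m :=
  fun a b => ((nat_of_ord a, nat_of_ord b) \in es) || ((nat_of_ord b, nat_of_ord a) \in es).

Definition induced_sub {m n : nat} (h : rel 'I_m) (e : rel 'I_n) : Prop :=
  exists phi : 'I_m -> 'I_n, injective phi /\ forall a b, h a b = e (phi a) (phi b).

Definition claw : rel 'I_4 := mk_graph 4 [:: (0,1); (0,2); (0,3)].
Definition fourK1 : rel 'I_4 := mk_graph 4 [::].
Definition wheel5 : rel 'I_6 :=
  mk_graph 6 [:: (0,1); (1,2); (2,3); (3,4); (4,0); (5,0); (5,1); (5,2); (5,3); (5,4)].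
Definition C5twin : rel 'I_6 :=
  mk_graph 6 [:: (0,1); (1,2); (2,3); (3,4); (4,0); (5,0); (5,1); (5,4)].
Definition P5twin : rel 'I_6 :=
  mk_graph 6 [:: (0,1); (1,2); (2,3); (3,4); (5,1); (5,2); (5,3)].
Definition K5e : rel 'I_5 :=
  mk_graph 5 [:: (0,2); (0,3); (0,4); (1,2); (1,3); (1,4); (2,3); (2,4); (3,4)].

Definition in_class {n : nat} (e : rel 'I_n) : Prop :=
  ~ induced_sub claw e /\ ~ induced_sub fourK1 e /\ ~ induced_sub wheel5 e /\
  ~ induced_sub C5twin e /\ ~ induced_sub P5twin e /\ ~ induced_sub K5e e.

Definition colorable {n : nat} (e : rel 'I_n) (k : nat) : bool :=
  [exists f : {ffun 'I_n -> 'I_k}, [forall x, forall y, e x y ==> (f x != f y)]].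

Lemma colorable_exists {n : nat} {e : rel 'I_n} (irr : irreflexive e) :
  exists k, colorable e k.
Proof.
exists n; apply/existsP; exists [ffun x => x]; apply/forallP => x; apply/forallP => y.
apply/implyP => exy; rewrite !ffunE; apply/eqP => Exy; subst y.
by rewrite irr in exy.
Qed.

Definition chromatic_number {n : nat} {e : rel 'I_n} (irr : irreflexive e) : nat :=
  ex_minn (colorable_exists irr).

(* Alphabet 'I_S.+3: symbol 0 = blank, 1 = bit false, 2 = bit true, others auxiliary.
   States 'I_Q.+1, start state 0. The machine halts when delta is undefined. *)
Inductive move := MoveL | MoveR | Stay.

Record TM := {
  tm_Q : nat;
  tm_S : nat;
  tm_delta : 'I_tm_Q.+1 -> 'I_tm_S.+3 -> option ('I_tm_Q.+1 * 'I_tm_S.+3 * move)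
}.

Definition sym (M : TM) := 'I_(tm_S M).+3.
Definition blank (M : TM) : sym M := ord0.
Definition bit_sym (M : TM) (b : bool) : sym M := inord (if b then 2 else 1).

(* configuration: state, tape left of head (nearest first), head symbol, tape right of head *)
Definition config (M : TM) := ('I_(tm_Q M).+1 * seq (sym M) * sym M * seq (sym M))%type.

Definition step (M : TM) (c : config M) : option (config M) :=
  let: (q, l, a, r) := c in
  match tm_delta M q a with
  | None => None
  | Some (q', b, mv) =>
    Some (match mv with
          | MoveL => match l with
                     | [::] => (q', [::], blank M, b :: r)
                     | x :: l' => (q', l', x, b :: r)
                     end
          | MoveR => match r with
                     | [::] => (q', b :: l, blank M, [::])
                     | x :: r' => (q', b :: l, x, r')
                     end
          | Stay => (q', l, b, r)
          end)
  end.

Fixpoint exec (M : TM) (k : nat) (c : config M) : config M :=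
  match k with
  | 0 => c
  | k'.+1 => let c' := exec M k' c in
             match step M c' with None => c' | Some c'' => c'' end
  end.

Definition halted {M : TM} (c : config M) : bool := step M c == None.

Definition init (M : TM) (w : seq bool) : config M :=
  match map (bit_sym M) w with
  | [::] => (ord0, [::], blank M, [::])
  | x :: r => (ord0, [::], x, r)
  end.

Definition is_bit (M : TM) (s : sym M) : bool := (0 < nat_of_ord s < 3)%N.

(* output: the maximal block of bit symbols starting at the head, read as a
   binary numeral, most significant bit first *)
Definition output {M : TM} (c : config M) : nat :=
  let: (_, _, a, r) := c in
  let t := a :: r in
  let bits := map (fun s : sym M => nat_of_ord s == 2) (take (find (predC (is_bit M)) t) t) in
  foldl (fun acc (b : bool) => acc.*2 + b) 0 bits.

Definition encode {n : nat} (e : rel 'I_n) : seq bool :=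
  [seq e i j | i <- enum 'I_n, j <- enum 'I_n].

(* Main.v *)
Require Import Defs.
From mathcomp Require Import all_boot zify.
Set Implicit Arguments.
Unset Strict Implicit.
Unset Printing Implicit Defensive.

(** As 4K_1 is excluded, a large graph of the class has a large clique, by
    Ramsey's theorem; let K be a maximum one. As K_5 - e is excluded, a vertex
    outside a clique C is complete to C or has at most two neighbours in C, and
    the vertices complete to a triangle form a clique. Hence the vertices outside
    K are few, or they split into two cliques; in both cases they can be coloured
    one clique after the other with the colours of K, so that chi(G) = |K|.
    Moreover |K| - 3 is the maximal number of common neighbours of three distinct
    vertices: three vertices that do not form a triangle have boundedly many
    common neighbours.

    The machine looks up the answer for the finitely many small inputs. For a
    large input it maximises the number of common neighbours of three rows of
    the adjacency matrix, keeping finitely many registers as marks on the cells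
    of the input, so that each register operation is one sweep over the tape. *)

(** * Cliques and colourings *)

(** Colouring a clique with the colours of K, next to vertices already coloured, means finding a
    system of distinct colours subject to conflicts. Excluding K_5 - e bounds the conflicts by a
    constant on both sides, per vertex and per colour, so an exchange argument suffices once K is
    large. The obstacle is a coloured vertex that is complete to the new clique, since its colour
    conflicts with the whole clique. Such colours are set aside; enough remain, because the new
    clique together with the vertices complete to it is again a clique, hence no larger than K.

    Triples of vertices are counted because the common neighbours of a triangle form a clique when
    K_5 - e is excluded. Counting them therefore replaces the search for a maximum clique. *)

Section Cliques.
Variables (T : finType) (e : rel T).

Definition clique (A : {set T}) := [forall x in A, forall y in A, (x != y) ==> e x y].
Definition indep (A : {set T}) := [forall x in A, forall y in A, ~~ e x y].

Lemma cliqueP (A : {set T}) :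
  reflect {in A &, forall x y, x != y -> e x y} (clique A).
Proof.
apply: (iffP forall_inP) => H x.
  by move=> y xA yA; have /forall_inP/(_ y yA)/implyP := H x xA.
by move=> xA; apply/forall_inP => y yA; apply/implyP; apply: H.
Qed.

Lemma indepP (A : {set T}) : reflect {in A &, forall x y, ~~ e x y} (indep A).
Proof.
apply: (iffP forall_inP) => H x.
  by move=> y xA yA; have /forall_inP/(_ y yA) := H x xA.
by move=> xA; apply/forall_inP => y yA; apply: H.
Qed.

Hypothesis sym_e : symmetric e.
Hypothesis irr_e : irreflexive e.

Lemma clique0 : clique set0.
Proof. by apply/cliqueP => x y; rewrite inE. Qed.

Lemma clique_sub (A C : {set T}) : A \subset C -> clique C -> clique A.
Proof.
move=> /subsetP AC /cliqueP H; apply/cliqueP => x y xA yA.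
by apply: H; apply: AC.
Qed.

Lemma cliqueU1 x (A : {set T}) : clique A -> {in A, forall y, e x y} -> clique (x |: A).
Proof.
move=> /cliqueP H Hx; apply/cliqueP => y z; rewrite !inE.
case/orP=> [/eqP->|yA]; case/orP=> [/eqP->|zA]; rewrite ?eqxx //.
- by move=> _; apply: Hx.
- by move=> _; rewrite sym_e; apply: Hx.
- exact: H.
Qed.

Lemma indepU1 x (A : {set T}) : indep A -> {in A, forall y, ~~ e x y} -> indep (x |: A).
Proof.
move=> /indepP H Hx; apply/indepP => y z; rewrite !inE.
case/orP=> [/eqP->|yA]; case/orP=> [/eqP->|zA]; rewrite ?irr_e //.
- exact: Hx.
- by rewrite sym_e; apply: Hx.
- exact: H.
Qed.

End Cliques.

(** Formulated for subsets [X] of the vertex set so that the induction on [a + b] can pass to the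
    neighbours and to the non-neighbours of a point inside [X]. *)
Theorem ramsey (a b : nat) : exists r, forall (T : finType) (e : rel T),
  symmetric e -> irreflexive e -> forall X : {set T}, r <= #|X| ->
  (exists2 A : {set T}, A \subset X & clique e A /\ a <= #|A|) \/
  (exists2 A : {set T}, A \subset X & indep e A /\ b <= #|A|).
Proof.
move Es: (a + b) => s; elim: s a b Es => [|s IH] a b Es.
  exists 0 => T e se ie X _; left; exists set0; rewrite ?sub0set ?clique0 ?cards0; split=> //; lia.
case: a Es => [|a] Es.
  exists 0 => T e se ie X _; left; exists set0; rewrite ?sub0set ?clique0 ?cards0; split=> //; lia.
case: b Es => [|b] Es.
  exists 0 => T e se ie X _; right; exists set0; rewrite ?sub0set ?cards0 //; split=> //.
  by apply/indepP => x y; rewrite inE.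
have [|r1 H1] := IH a b.+1; first by lia.
have [|r2 H2] := IH a.+1 b; first by lia.
exists (r1 + r2).+1 => T e se ie X HX.
have [x xX] : exists x, x \in X by apply/set0Pn; rewrite -card_gt0; lia.
pose N := [set y in X :\ x | e x y]; pose N' := [set y in X :\ x | ~~ e x y].
have HN : #|X| = (#|N| + #|N'|).+1.
  rewrite (cardsD1 x X) xX -(cardsID [set y | e x y] (X :\ x)).
  by rewrite add1n; congr (_ + _).+1; apply: eq_card => y; rewrite !inE // andbC.
have sN : N \subset X by apply/subsetP => y; rewrite !inE => /andP[/andP[]].
have sN' : N' \subset X by apply/subsetP => y; rewrite !inE => /andP[/andP[]].
have [HN1|HN2] : r1 <= #|N| \/ r2 <= #|N'| by lia.
- have [[A sA [cA hA]]|[A sA hA]] := H1 T e se ie N HN1; last first.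
    by right; exists A => //; apply: subset_trans sA sN.
  left; exists (x |: A).
    by rewrite subUset sub1set xX (subset_trans sA sN).
  split.
    by apply: cliqueU1 => // y /(subsetP sA); rewrite !inE => /andP[].
  rewrite cardsU1; have -> : x \notin A; last by lia.
  by apply/negP => /(subsetP sA); rewrite !inE eqxx.
- have [[A sA hA]|[A sA [cA hA]]] := H2 T e se ie N' HN2.
    by left; exists A => //; apply: subset_trans sA sN'.
  right; exists (x |: A).
    by rewrite subUset sub1set xX (subset_trans sA sN').
  split.
    by apply: indepU1 => // y /(subsetP sA); rewrite !inE => /andP[].
  rewrite cardsU1; have -> : x \notin A; last by lia.
  by apply/negP => /(subsetP sA); rewrite !inE eqxx.
Qed.

(* Insert the points of A one by one; when every free value conflicts with the
   new point, exchange a free value with one that is already used. *)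
Lemma injection_avoiding (T U : finType) (conf : T -> U -> bool) (d : nat)
    (A : {set T}) (Y : {set U}) :
  #|A| <= #|Y| -> 3 * d < #|Y| ->
  {in A, forall a, #|[set y in Y | conf a y]| <= d} ->
  {in Y, forall y, #|[set a in A | conf a y]| <= d} ->
  exists f : T -> U,
    [/\ {in A &, injective f}, {in A, forall a, f a \in Y}
      & {in A, forall a, ~~ conf a (f a)}].
Proof.
move=> + Yd; move Es: #|A| => s; elim: s A Es => [|s IH] A Es sY HA HY.
  have [y0 _] : exists y, y \in Y by apply/set0Pn; rewrite -card_gt0; lia.
  move/eqP: Es; rewrite cards_eq0 => /eqP ->.
  by exists (fun _ => y0); split=> [x y|x|x]; rewrite inE.
have [a aA] : exists x, x \in A by apply/set0Pn; rewrite -card_gt0; lia.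
pose A' := A :\ a.
have EA' : #|A'| = s by have := cardsD1 a A; rewrite aA -/A'; lia.
have inA' x : x \in A' -> x \in A by rewrite !inE => /andP[].
have [||||f [fi fY fc]] := IH A'; rewrite ?EA' //; first by lia.
- by move=> x /inA'; apply: HA.
- move=> y yY; apply: leq_trans (HY y yY); apply: subset_leq_card.
  by apply/subsetP => x; rewrite !inE => /andP[/andP[_ ->] ->].
pose F := Y :\: [set f x | x in A'].
have fimg : [set f x | x in A'] \subset Y.
  by apply/subsetP => _ /imsetP[x xA ->]; apply: fY.
have EF : #|F| + s = #|Y|.
  have := cardsID [set f x | x in A'] Y.
  rewrite (setIidPr fimg) card_in_imset // EA' -/F; lia.
have FY y : y \in F -> y \in Y by rewrite inE => /andP[].
have Ff y x : y \in F -> x \in A' -> f x != y.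
  rewrite inE => /andP[yn _] xA; apply: contra yn => /eqP <-; exact: imset_f.
case: (boolP [exists y in F, ~~ conf a y]) => [/exists_inP[y yF cy]|Hn].
  exists (fun x => if x == a then y else f x); split.
  - move=> x1 x2 x1A x2A; case: eqP => [->|/eqP n1]; case: eqP => [-> //|/eqP n2].
    + by move=> E; have := Ff y x2 yF; rewrite -E eqxx !inE n2 x2A => /(_ isT).
    + by move=> E; have := Ff y x1 yF; rewrite E eqxx !inE n1 x1A => /(_ isT).
    + by apply: fi; rewrite !inE ?n1 ?n2.
  - by move=> x xA; case: eqP => [_|/eqP n1]; [exact: FY|apply: fY; rewrite !inE n1].
  - by move=> x xA; case: eqP => [->|/eqP n1] //; apply: fc; rewrite !inE n1.
(* Every free value conflicts with [a], so at most [d] values are free and, as [3 * d < #|Y|], more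
   than [2 * d] points already have one. At most [d] of them hold a value conflicting with [a]
   ([B1]), and at most [d] conflict with the free value [y] ([B2]). Any other point [x] can give its
   value to [a] and take [y]. *)
have Fd : #|F| <= d.
  apply: leq_trans (HA a aA); apply: subset_leq_card; apply/subsetP => y yF.
  rewrite inE FY //=; move: Hn; rewrite negb_exists_in => /forall_inP/(_ y yF).
  by rewrite negbK.
have [y yF] : exists y, y \in F by apply/set0Pn; rewrite -card_gt0; lia.
pose B1 := [set x in A' | conf a (f x)]; pose B2 := [set x in A | conf x y].
have B1d : #|B1| <= d.
  apply: leq_trans (HA a aA).
  rewrite -(@card_in_imset _ _ f B1); last first.
    by move=> x1 x2; rewrite !inE => /andP[h1 _] /andP[h2 _]; apply: fi; rewrite !inE.
  apply: subset_leq_card; apply/subsetP => _ /imsetP[x + ->].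
  by case/setIdP=> xA' cx; rewrite inE fY.
have B2d := HY y (FY y yF); rewrite -/B2 in B2d.
have [x xA' xB] : exists2 x, x \in A' & x \notin B1 :|: B2.
  have : 0 < #|A' :\: (B1 :|: B2)|.
    have := cardsID (B1 :|: B2) A'; have := cardsU B1 B2.
    have := subset_leq_card (subsetIr A' (B1 :|: B2)); lia.
  by rewrite card_gt0 => /set0Pn[x]; rewrite inE => /andP[]; exists x.
have xA := inA' x xA'.
have xa : x != a by move: xA'; rewrite !inE => /andP[].
have {xB}[c1 c2] : ~~ conf a (f x) /\ ~~ conf x y.
  by move: xB; rewrite in_setU ![_ \in [set _ in _ | _]]inE xA' xA /= negb_or => /andP[].
exists (fun z => if z == a then f x else if z == x then y else f z); split.
- have key z : z \in A -> z != a -> z != x -> (f x != f z) && (f z != y).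
    move=> zA za zx; have zA' : z \in A' by rewrite !inE za.
    rewrite (Ff y z) // andbT; apply: contra zx => /eqP E; apply/eqP.
    exact: (fi z x zA' xA' (esym E)).
  have fxy : f x != y by apply: Ff.
  move=> z1 z2 z1A z2A.
  case: (eqVneq z1 a) => [->|n1]; case: (eqVneq z2 a) => [-> //|n2].
  + case: (eqVneq z2 x) => [_ E|m2 E]; first by rewrite E eqxx in fxy.
    by have := key z2 z2A n2 m2; rewrite E eqxx.
  + case: (eqVneq z1 x) => [_ E|m1 E]; first by rewrite E eqxx in fxy.
    by have := key z1 z1A n1 m1; rewrite E eqxx.
  + case: (eqVneq z1 x) => [->|m1]; case: (eqVneq z2 x) => [-> //|m2].
    * by move=> E; have := key z2 z2A n2 m2; rewrite E eqxx andbF.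
    * by move=> E; have := key z1 z1A n1 m1; rewrite E eqxx andbF.
    * by apply: fi; rewrite !inE ?n1 ?n2.
- move=> z zA; case: (eqVneq z a) => [_|n1]; first exact: fY.
  by case: (eqVneq z x) => [_|m1]; [exact: FY|apply: fY; rewrite !inE n1].
- move=> z zA; case: (eqVneq z a) => [->|n1] //.
  by case: (eqVneq z x) => [->|m1] //; apply: fc; rewrite !inE n1.
Qed.

Lemma card_bigcup_le (T U : finType) (X : {set T}) (F : T -> {set U}) d :
  {in X, forall x, #|F x| <= d} -> #|\bigcup_(x in X) F x| <= #|X| * d.
Proof.
move=> H; rewrite -sum_nat_const.
apply: (big_ind2 (fun (A : {set U}) m => #|A| <= m)) => [|A m C k HA HC|x xX].
- by rewrite cards0.
- by rewrite (leq_trans (leq_card_setU _ _)) // leq_add.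
- exact: H.
Qed.

(** * Structure and colouring around a maximum clique *)

Section Structure.
Variables (T : finType) (e : rel T).
Hypothesis sym_e : symmetric e.
Hypothesis irr_e : irreflexive e.
Hypothesis free4K1 : forall A : {set T}, indep e A -> #|A| <= 3.
Hypothesis freeK5e : forall x y (A : {set T}), x != y -> ~~ e x y -> clique e A ->
  {in A, forall a, e x a && e y a} -> #|A| <= 2.

Definition nbrs (v : T) (C : {set T}) := [set y in C | e v y].
Definition complete_to (C : {set T}) := [set v | [forall y in C, e v y]].

(** If [v] misses [d] in [C], then [v] and [d] both see every neighbour of [v] in [C], and three
    such neighbours would complete a K_5 - e. *)
Lemma nbrs_clique (C : {set T}) v : clique e C -> v \notin C ->
  v \in complete_to C \/ #|nbrs v C| <= 2.
Proof.
move=> cC vC; case: (boolP (v \in complete_to C)) => [|H]; first by left.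
right; move: H; rewrite inE negb_forall_in => /exists_inP[d dC nvd].
apply: (@freeK5e v d) => //.
- by apply: contraNneq vC => ->.
- by apply: clique_sub cC; apply/subsetP => y; rewrite inE => /andP[].
move=> a; rewrite inE => /andP[aC va]; rewrite va /=.
by move/cliqueP: cC; apply=> //; apply: contraNneq nvd => ->.
Qed.

(** Two non-adjacent vertices complete to [C] would form a K_5 - e with three vertices of [C]. *)
Lemma complete_clique (C : {set T}) : clique e C -> 2 < #|C| ->
  clique e (C :|: complete_to C).
Proof.
move=> cC C3; apply/cliqueP => x y.
have h z a : z \in complete_to C -> a \in C -> e z a.
  by rewrite inE => /forall_inP; apply.
rewrite !in_setU => /orP[xC|xC] /orP[yC|yC] xy.
- by move/cliqueP: cC; apply.
- by rewrite sym_e; apply: h.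
- exact: h.
apply/negPn/negP => nxy.
have := @freeK5e x y C xy nxy cC; rewrite leqNgt C3 => H.
by apply: notF; apply: H => a aC; rewrite !h.
Qed.

Lemma disjoint_complete (C : {set T}) : [disjoint C & complete_to C].
Proof.
rewrite disjoint_subset; apply/subsetP => x xC; rewrite !inE; apply/negP.
by move/forall_inP/(_ x xC); rewrite irr_e.
Qed.

Variable K : {set T}.
Hypothesis maxK : forall C : {set T}, clique e C -> #|C| <= #|K|.

Definition common (u v w : T) := [set x | [&& e u x, e v x & e w x]].

(** If two of the three vertices are non-adjacent, [r] common neighbours would contain a triangle,
    giving a K_5 - e, or four independent vertices. If they form a triangle, they make up a clique
    together with all their common neighbours. *)
Lemma common_ub (r : nat) u v w : r + 3 <= #|K| ->
  (forall X : {set T}, r <= #|X| ->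
    (exists2 A : {set T}, A \subset X & clique e A /\ 3 <= #|A|) \/
    (exists2 A : {set T}, A \subset X & indep e A /\ 4 <= #|A|)) ->
  u != v -> u != w -> v != w -> #|common u v w| + 3 <= #|K|.
Proof.
move=> Kr ram uv uw vw.
have small p q : p != q -> ~~ e p q ->
    {in common u v w, forall x, e p x && e q x} -> #|common u v w| < r.
  move=> pq npq H; rewrite ltnNge; apply/negP => /ram [] [A sA [hA cA]].
    have := @freeK5e p q A pq npq hA; rewrite leqNgt cA => F; apply: notF; apply: F.
    by move=> a /(subsetP sA) /H.
  by have := free4K1 hA; lia.
have inC x : x \in common u v w -> [/\ e u x, e v x & e w x].
  by rewrite inE => /and3P.
have [euv|nuv] := boolP (e u v); last first.
  have := small u v uv nuv; suff H : {in common u v w, forall x, e u x && e v x}.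
    by move=> /(_ H); lia.
  by move=> x /inC[-> ->].
have [euw|nuw] := boolP (e u w); last first.
  have := small u w uw nuw; suff H : {in common u v w, forall x, e u x && e w x}.
    by move=> /(_ H); lia.
  by move=> x /inC[-> _ ->].
have [evw|nvw] := boolP (e v w); last first.
  have := small v w vw nvw; suff H : {in common u v w, forall x, e v x && e w x}.
    by move=> /(_ H); lia.
  by move=> x /inC[_ -> ->].
have ctri : clique e [set u; v; w].
  by apply/cliqueP => x y; rewrite !inE => /orP[/orP[]|] /eqP-> /orP[/orP[]|] /eqP->;
     rewrite ?eqxx // sym_e.
have cC : clique e (common u v w).
  apply/cliqueP => x y xC yC xy; apply/negPn/negP => nxy.
  have := @freeK5e x y _ xy nxy ctri.
  have -> : #|[set u; v; w]| = 3.
    by rewrite -setUA cardsU1 cards2 vw !inE negb_or uv uw.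
  move=> F; apply: notF; apply: F => a.
  have [ux vx wx] := inC x xC; have [uy vy wy] := inC y yC.
  by rewrite !inE => /orP[/orP[]|] /eqP->; rewrite !(sym_e _ u, sym_e _ v, sym_e _ w)
       ?ux ?vx ?wx ?uy ?vy ?wy.
have c1 : clique e (w |: common u v w) by apply: cliqueU1 => // y /inC[].
have c2 : clique e (v |: (w |: common u v w)).
  by apply: cliqueU1 => // y; rewrite in_setU1 => /orP[/eqP->|/inC[]].
have c3 : clique e (u |: (v |: (w |: common u v w))).
  by apply: cliqueU1 => // y; rewrite !in_setU1 => /or3P[/eqP->|/eqP->|/inC[]].
have := maxK c3; rewrite !cardsU1 !in_setU1 !negb_or uv uw vw.
by rewrite ![_ \in common _ _ _]inE !irr_e /= ?andbF /=; lia.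
Qed.

(** The colours are the vertices of [K], so that the identity colours [K] and #|K| colours are used
    in all. *)
Definition proper_on (D : {set T}) (c : T -> T) :=
  {in D, forall x, c x \in K} /\ {in D &, forall x y, e x y -> c x != c y}.

(** A colour conflicts only with the neighbours in [A] of the at most two vertices of [D] that carry
    it, and each of these has at most two such neighbours unless it is complete to [A]. Hence
    [d = 4] in [injection_avoiding], once the colours [E] of the complete vertices are removed.
    There are at most four of those, and [16 < #|K|] leaves more than [3 * 4] colours. *)
Lemma extend_coloring (D A : {set T}) (c : T -> T) :
  16 < #|K| -> proper_on D c -> clique e A -> [disjoint D & A] ->
  {in A, forall a, #|nbrs a D| <= 4} ->
  (forall k, #|[set x in D | c x == k]| <= 2) ->
  exists c', [/\ proper_on (D :|: A) c', {in D, c' =1 c} & {in A &, injective c'}].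
Proof.
move=> K16 [cDK cDp] cA dDA Anb cl2.
have DA x : x \in D -> x \in A = false by move/(disjointFr dDA).
pose conf a k := [exists x in D, (c x == k) && e a x].
suff [Y sYK [f [fi fY fc]]] : exists2 Y : {set T}, Y \subset K &
    exists f : T -> T, [/\ {in A &, injective f}, {in A, forall a, f a \in Y}
      & {in A, forall a, ~~ conf a (f a)}].
  have fc' a x : a \in A -> x \in D -> e a x -> f a != c x.
    move=> aA xD ax; apply: contraNneq (fc a aA) => E.
    by apply/exists_inP; exists x => //; rewrite E eqxx.
  exists (fun x => if x \in A then f x else c x); split.
  - split=> [x|x y]; rewrite !in_setU.
      case: ifP => xA; rewrite ?orbF ?orbT => xD; last exact: cDK.
      by apply: (subsetP sYK); apply: fY.
    case: ifP => xA; case: ifP => yA; rewrite ?orbF ?orbT => xD yD exy.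
    + by apply: contraTneq exy => /fi -> //; rewrite irr_e.
    + exact: fc'.
    + by rewrite eq_sym; apply: fc'; rewrite // sym_e.
    + exact: cDp.
  - by move=> x xD; rewrite DA.
  - by move=> x y xA yA; rewrite xA yA; apply: fi.
have confA (Y : {set T}) a : a \in A -> #|[set y in Y | conf a y]| <= 4.
  move=> aA; apply: leq_trans (Anb a aA); apply: leq_trans (leq_imset_card c _).
  apply: subset_leq_card; apply/subsetP => y; rewrite inE => /andP[_ /exists_inP[x xD]].
  by case/andP=> /eqP <- ax; apply: imset_f; rewrite inE xD.
(* For at most two vertices no colour has to be set aside, since a colour conflicts with at most
   #|A| of them; [complete_clique] is available from three on. *)
have [A3|A3] := leqP #|A| 2.
  exists K => //; apply: (@injection_avoiding _ _ conf 4); try lia.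
    by move=> a; apply: confA.
  move=> y _; apply: (@leq_trans #|A|); last by lia.
  by apply: subset_leq_card; apply/subsetP => x; rewrite inE => /andP[].
pose E := [set c x | x in D :&: complete_to A].
have Ele : #|E| <= #|D :&: complete_to A| by apply: leq_imset_card.
have E1 : #|E| <= #|complete_to A|.
  by apply: leq_trans Ele _; apply: subset_leq_card; apply: subsetIr.
(* The vertices of [D] complete to [A] are all neighbours of one single [a] in [A]. *)
have E4 : #|E| <= 4.
  have [a aA] : exists a, a \in A by apply/set0Pn; rewrite -card_gt0; lia.
  apply: leq_trans Ele _; apply: leq_trans (Anb a aA); apply: subset_leq_card.
  apply/subsetP => x; rewrite !inE => /andP[-> /forall_inP/(_ a aA)].
  by rewrite sym_e.
have EA : #|A| + #|complete_to A| <= #|K|.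
  apply: leq_trans (maxK (complete_clique cA A3)).
  by rewrite cardsU (eqP (_ : A :&: _ == set0)) ?cards0 ?subn0 // setI_eq0 disjoint_complete.
have KE : #|K| <= #|K :\: E| + #|E|.
  by have := cardsID E K; have := subset_leq_card (subsetIr K E); lia.
exists (K :\: E); first exact: subsetDl.
apply: (@injection_avoiding _ _ conf 4); try lia.
  by move=> a; apply: confA.
move=> y; rewrite in_setD => /andP[yE yK].
pose X := [set x in D | c x == y].
apply: (@leq_trans #|\bigcup_(x in X) nbrs x A|).
  apply: subset_leq_card; apply/subsetP => a; rewrite inE => /andP[aA /exists_inP[x xD]].
  case/andP=> /eqP cx ax; apply/bigcupP; exists x; first by rewrite inE xD cx eqxx.
  by rewrite inE aA sym_e.
apply: (@leq_trans (#|X| * 2)); last by have := cl2 y; rewrite -/X; lia.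
apply: card_bigcup_le => x; rewrite inE => /andP[xD /eqP cx].
have [xc|//] := nbrs_clique cA (negbT (DA x xD)).
by case/negP: yE; rewrite -cx; apply: imset_f; rewrite inE xD.
Qed.

(** Maximality is relative to [H] so that the lemma serves for [K] among all vertices and for a
    second clique among the vertices outside [K]. *)
Lemma nbrs_maxclique (C H : {set T}) v : clique e C ->
  (forall C' : {set T}, clique e C' -> C' \subset H -> #|C'| <= #|C|) ->
  C \subset H -> v \in H -> v \notin C -> #|nbrs v C| <= 2.
Proof.
move=> cC mC sC vH vC; have [vc|//] := nbrs_clique cC vC.
have := mC (v |: C); rewrite subUset sub1set vH sC cardsU1 vC ltnn.
move=> H1; apply: contraTT isT => _; apply: H1 => //; apply: cliqueU1 => // y yC.
by move: vc; rewrite inE => /forall_inP; apply.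
Qed.

Hypothesis cK : clique e K.

Lemma nbrs_outsideK v : v \notin K -> #|nbrs v K| <= 2.
Proof.
by apply: (@nbrs_maxclique K setT) => // C cC _; exact: maxK.
Qed.

Lemma avoid_in_clique (C S : {set T}) : {in S, forall v, #|nbrs v C| <= 2} ->
  #|S| * 2 < #|C| -> exists2 x, x \in C & {in S, forall v, ~~ e x v}.
Proof.
move=> HS SC; have := card_bigcup_le HS.
set U := \bigcup_(_ in _) _ => HU.
have : 0 < #|C :\: U|.
  by have := cardsID U C; have := subset_leq_card (subsetIr C U); lia.
rewrite card_gt0 => /set0Pn[x]; rewrite inE => /andP[xU xC]; exists x => // v vS.
apply: contra xU => xv; apply/bigcupP; exists v => //.
by rewrite inE xC sym_e.
Qed.

Lemma proper_onK : proper_on K id.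
Proof. by split=> // x y _ _ exy; apply: contraTneq exy => ->; rewrite irr_e. Qed.

(** Three vertices outside [K] have at most six neighbours in [K] in total, so a seventh vertex of
    [K] would extend an independent triple to 4K_1. *)
Lemma outside_indep (S : {set T}) : 7 <= #|K| -> [disjoint K & S] -> indep e S -> #|S| <= 2.
Proof.
move=> K7 dKS iS; rewrite leqNgt; apply/negP => S3.
have S4 := free4K1 iS.
have [v vS||x xK xS] := @avoid_in_clique K S; last 1 first.
- have := free4K1 (indepU1 sym_e irr_e iS xS).
  by rewrite cardsU1 (disjointFr dKS xK); lia.
- by apply: nbrs_outsideK; rewrite (disjointFl dKS vS).
- by lia.
Qed.

(** A clique of five is asked for because two vertices with at most two neighbours each in it leave
    one of its vertices unseen. The alternative, three independent vertices outside [K], is ruled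
    out by [outside_indep]. *)
Lemma colorK (r : nat) : 16 < #|K| -> 3 * r < #|K| ->
  (forall X : {set T}, r <= #|X| ->
    (exists2 A : {set T}, A \subset X & clique e A /\ 5 <= #|A|) \/
    (exists2 A : {set T}, A \subset X & indep e A /\ 3 <= #|A|)) ->
  exists c, proper_on setT c.
Proof.
move=> K16 Kr ram; pose H := ~: K.
have inH x : (x \in H) = (x \notin K) by rewrite inE.
(* Few vertices outside [K] all get different colours. As colours are vertices of [K], adjacency
   itself is the conflict relation: a vertex meets at most 2 colours and a colour at most [#|H| < r]
   vertices, hence [maxn 2 r]. *)
have [Hr|Hr] := ltnP #|H| r.
  have [||a|y _|f [fi fK fc]] := @injection_avoiding _ _ e (maxn 2 r) H K; try lia.
  - by rewrite inH => /nbrs_outsideK; rewrite leq_max => ->.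
  - apply: (@leq_trans #|H|); last by lia.
    by apply: subset_leq_card; apply/subsetP => x; rewrite inE => /andP[].
  exists (fun x => if x \in K then x else f x); split=> [x _|x y _ _].
    by case: ifPn => //; rewrite -inH; apply: fK.
  case: ifPn => xK; case: ifPn => yK exy.
  - by apply: contraTneq exy => ->; rewrite irr_e.
  - by apply: contraNneq (fc y _) => [<-|]; rewrite ?inH // sym_e.
  - by apply: contraNneq (fc x _) => [->|]; rewrite ?inH.
  - by apply: contraTneq exy => /fi ->; rewrite ?inH // irr_e.
have [A0 sA0 [cA0 hA0]] : exists2 A : {set T}, A \subset H & clique e A /\ 5 <= #|A|.
  case: (ram H Hr) => // -[A sA [iA hA]].
  have : #|A| <= 2; last by rewrite leqNgt hA.
  apply: outside_indep => //; first by lia.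
  by rewrite disjoint_sym disjoints_subset.
pose P (X : {set T}) := clique e X && (X \subset H).
have PA0 : P A0 by rewrite /P cA0.
pose K2 := [arg max_(X > A0 | P X) #|X|].
have [cK2 sK2 mK2 K2_5] : [/\ clique e K2, K2 \subset H,
    forall C : {set T}, clique e C -> C \subset H -> #|C| <= #|K2| & 5 <= #|K2|].
  rewrite /K2; case: arg_maxnP => // X /andP[cX sX] mX; split=> //.
    by move=> C cC sC; apply: mX; rewrite /P cC.
  exact: leq_trans hA0 (mX _ PA0).
pose R := H :\: K2.
have inR x : (x \in R) = (x \notin K) && (x \notin K2) by rewrite in_setD inH andbC.
have RK2 x : x \in R -> #|nbrs x K2| <= 2.
  rewrite inR => /andP[xK xK2]; apply: (nbrs_maxclique cK2 mK2) => //.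
  by rewrite inH.
have K2K x : x \in K2 -> x \notin K by move/(subsetP sK2); rewrite inH.
(* Two non-adjacent vertices of [R] see at most four vertices of [K2]; a fifth one would form an
   independent triple outside [K] with them. *)
have cR : clique e R.
  apply/cliqueP => x y xR yR xy; apply/negPn/negP => nxy.
  have [v|//|z zK2 Hz] := @avoid_in_clique K2 [set x; y].
  - by case/set2P=> ->; apply: RK2.
  - by rewrite cards2 xy; lia.
  have zx : z \notin [set x; y].
    by apply/negP => /set2P[] E; move: zK2; rewrite E; apply/negP; 
       [move: xR|move: yR]; rewrite inR => /andP[].
  have : #|z |: [set x; y]| <= 2; last by rewrite cardsU1 cards2 xy zx.
  apply: outside_indep; first by lia.
    rewrite disjoint_sym disjoints_subset; apply/subsetP => v.
    rewrite !inE => /or3P[] /eqP ->; first exact: K2K.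
      by move: xR; rewrite inR => /andP[].
    by move: yR; rewrite inR => /andP[].
  apply: indepU1 => //; apply/indepP => v w /set2P[] -> /set2P[] ->; rewrite ?irr_e //.
  by rewrite sym_e.
have dK2 : [disjoint K & K2].
  by rewrite disjoint_sym disjoints_subset -/H.
have [|k|c1 [pc1 c1K c1i]] := extend_coloring K16 proper_onK cK2 dK2.
- by move=> a /K2K /nbrs_outsideK; lia.
- apply: (@leq_trans #|[set k]|); last by rewrite cards1.
  by apply: subset_leq_card; apply/subsetP => x; rewrite !inE => /andP[].
(* A vertex of [R] has at most two neighbours in each of [K] and [K2], and each colour occurs at
   most once in each. This is the origin of the bounds 4 and 2 in [extend_coloring]. *)
have [||k|c2 [pc2 _ _]] := extend_coloring K16 pc1 cR.
- rewrite disjoint_sym disjoints_subset; apply/subsetP => x.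
  by rewrite inR in_setC in_setU negb_or.
- move=> a aR; have aK : a \notin K by move: aR; rewrite inR => /andP[].
  have := nbrs_outsideK aK; have := RK2 a aR.
  have -> : nbrs a (K :|: K2) = nbrs a K :|: nbrs a K2.
    by apply/setP => x; rewrite !inE andb_orl.
  by have := leq_of_leqif (leq_card_setU (nbrs a K) (nbrs a K2)); lia.
- have H1 : #|[set x in K | c1 x == k]| <= 1.
    apply: (@leq_trans #|[set k]|); last by rewrite cards1.
    apply: subset_leq_card; apply/subsetP => x; rewrite !inE => /andP[xK].
    by rewrite c1K.
  have H2 : #|[set x in K2 | c1 x == k]| <= 1.
    apply/card_le1P => x; rewrite inE => /andP[xK /eqP Ex] y; rewrite !inE.
    apply/andP/eqP => [[yK /eqP Ey]|->]; last by rewrite xK Ex.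
    by apply: c1i => //; rewrite Ey.
  have -> : [set x in K :|: K2 | c1 x == k] =
      [set x in K | c1 x == k] :|: [set x in K2 | c1 x == k].
    by apply/setP => x; rewrite !inE andb_orl.
  by have := leq_of_leqif (leq_card_setU [set x in K | c1 x == k] [set x in K2 | c1 x == k]); lia.
exists c2; suff <- : K :|: K2 :|: R = setT by [].
by apply/setP => x; rewrite in_setU in_setU inR inE; case: (x \in K); case: (x \in K2).
Qed.

Lemma common_lb u v w : u \in K -> v \in K -> w \in K ->
  #|K| <= #|common u v w| + 3.
Proof.
move=> uK vK wK; apply: (@leq_trans #|common u v w :|: [set u; v; w]|).
  apply: subset_leq_card; apply/subsetP => x xK.
  rewrite !inE -orbA.
  have [->|xu] := eqVneq x u; first by rewrite orbT.
  have [->|xv] := eqVneq x v; first by rewrite !orbT.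
  have [->|xw] := eqVneq x w; first by rewrite !orbT.
  by move/cliqueP: cK => cK'; rewrite !cK' // eq_sym.
apply: leq_trans (leq_card_setU _ _) _; rewrite leq_add2l.
apply: leq_trans (leq_card_setU _ _) _; rewrite cards1 cards2; lia.
Qed.

End Structure.

(** * From forbidden induced subgraphs to the chromatic number *)

Section Class.
Variables (n : nat) (e : rel 'I_n).
Hypothesis sym_e : symmetric e.
Hypothesis irr_e : irreflexive e.
Hypothesis class_e : in_class e.

Lemma induced_sub_nth (m : nat) (h : rel 'I_m) (s : seq 'I_n) (x0 : 'I_n) :
  size s = m -> uniq s -> (forall a b : 'I_m, h a b = e (nth x0 s a) (nth x0 s b)) ->
  induced_sub h e.
Proof.
move=> Es us H; exists (fun a => nth x0 s a); split=> // a b E.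
by apply/ord_inj/eqP; rewrite -(nth_uniq x0 _ _ us) ?Es ?E.
Qed.

Lemma class_free4K1 (A : {set 'I_n}) : indep e A -> #|A| <= 3.
Proof.
move=> /indepP iA; rewrite leqNgt; apply/negP => A4.
have /card_gt0P[x0 _] : 0 < #|A| by lia.
case: class_e => _ [nK _]; apply: nK.
apply: (@induced_sub_nth _ _ (take 4 (enum A)) x0).
- by rewrite size_takel // -cardE.
- by rewrite take_uniq // enum_uniq.
- have inA (a : 'I_4) : nth x0 (take 4 (enum A)) a \in A.
    by rewrite nth_take // -mem_enum mem_nth // -cardE (leq_trans (ltn_ord a)).
  by move=> a b; rewrite (negbTE (iA _ _ (inA a) (inA b))).
Qed.

Lemma class_freeK5e x y (A : {set 'I_n}) : x != y -> ~~ e x y -> clique e A ->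
  {in A, forall a, e x a && e y a} -> #|A| <= 2.
Proof.
move=> xy nxy /cliqueP cA Hxy; rewrite leqNgt; apply/negP => A3.
case: class_e => _ [_ [_ [_ [_ nK]]]]; apply: nK.
have us : uniq (take 3 (enum A)) by rewrite take_uniq // enum_uniq.
have ss : size (take 3 (enum A)) = 3.
  by rewrite size_takel // -cardE.
have sA a : a \in take 3 (enum A) -> a \in A by move/mem_take; rewrite mem_enum.
case: (take _ _) ss us sA => [|a [|b [|c [|]]]] //= _ us sA.
have [aA bA cA'] : [/\ a \in A, b \in A & c \in A] by split; apply: sA; rewrite !inE eqxx ?orbT.
move: us; rewrite !inE negb_or => /and3P[/andP[ab ac] bc _].
have ne z u : u \in A -> e z u -> z != u by move=> _; apply: contraTneq => ->; rewrite irr_e.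
have [/andP[xa ya] /andP[xb yb] /andP[xc yc]] := And3 (Hxy a aA) (Hxy b bA) (Hxy c cA').
have [eab eac ebc] := And3 (cA a b aA bA ab) (cA a c aA cA' ac) (cA b c bA cA' bc).
(* Vertices 0 and 1 are the non-adjacent pair of [K5e], so [x] and [y] come first. *)
apply: (@induced_sub_nth _ _ [:: x; y; a; b; c] x) => //.
  by rewrite /= !inE !negb_or xy ab ac bc !ne.
have s2 := sym_e.
do 5?[case=> [[|[|[|[|[|//]]]]] ia]] => -[[|[|[|[|[|//]]]]] ib] //=;
  rewrite ?irr_e ?(negbTE nxy) ?xa ?ya ?xb ?yb ?xc ?yc ?eab ?eac ?ebc //;
  rewrite s2 ?(negbTE nxy) ?xa ?ya ?xb ?yb ?xc ?yc ?eab ?eac ?ebc //.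
Qed.

Lemma clique_colorable (C : {set 'I_n}) k : clique e C -> colorable e k -> #|C| <= k.
Proof.
move=> /cliqueP cC /existsP[f /forallP Hf].
rewrite -[k]card_ord -(@card_in_imset _ _ f C) ?max_card // => x y xC yC E.
apply: contraTeq isT => xy; have /forallP/(_ y)/implyP := Hf x.
by rewrite cC // E eqxx => /(_ isT).
Qed.

Lemma proper_colorable (K : {set 'I_n}) c : 0 < #|K| -> proper_on e K setT c ->
  colorable e #|K|.
Proof.
case/card_gt0P=> x0 x0K [cK cp]; apply/existsP.
exists [ffun x => enum_rank_in x0K (c x)]; apply/forallP => x; apply/forallP => y.
apply/implyP => exy; rewrite !ffunE; apply: contra (cp x y _ _ exy); rewrite ?inE //.
by move/eqP/(congr1 enum_val); rewrite !enum_rankK_in ?cK ?inE // => ->.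
Qed.

End Class.

Theorem chromatic_number_common : exists N0, forall n (e : rel 'I_n)
  (sym_e : symmetric e) (irr_e : irreflexive e), in_class e -> N0 <= n ->
  exists mu, [/\ chromatic_number irr_e = mu + 3,
    forall u v w : 'I_n, u < v < w -> #|common e u v w| <= mu &
    exists u v w : 'I_n, u < v < w /\ #|common e u v w| = mu].
Proof.
have [r1 ram1] := ramsey 5 3; have [r2 ram2] := ramsey 3 4.
(* The clique must exceed 16 and [3 * r1] for [colorK], and reach [r2 + 3] for [common_ub]. *)
have [r ram] := ramsey (17 + 3 * r1 + r2) 4.
exists r => n e sym_e irr_e class_e rn.
have f4 := class_free4K1 class_e; have f5 := class_freeK5e sym_e irr_e class_e.
have [A0 cA0 hA0] : exists2 A : {set 'I_n}, clique e A & 17 + 3 * r1 + r2 <= #|A|.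
  have [|[A _ [cA hA]]|[A _ [/f4 hA hA4]]] := ram _ e sym_e irr_e [set: 'I_n].
  - by rewrite cardsT card_ord.
  - by exists A.
  - by move: hA; rewrite leqNgt hA4.
have [K [cK mK hK]] : exists K : {set 'I_n}, [/\ clique e K,
    forall C : {set 'I_n}, clique e C -> #|C| <= #|K| &
    17 + 3 * r1 + r2 <= #|K|].
  exists [arg max_(X > A0 | clique e X) #|X|]; case: arg_maxnP => // X cX mX; split=> //.
  exact: leq_trans hA0 (mX _ cA0).
have ub (u v w : 'I_n) : u < v < w -> #|common e u v w| + 3 <= #|K|.
  move=> /andP[uv vw].
  apply: (common_ub (r := r2) sym_e irr_e f4 f5 mK); [by apply: leq_trans hK; lia|exact: ram2| | |].
  - by rewrite neq_ltn uv.
  - by rewrite neq_ltn (ltn_trans uv vw).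
  - by rewrite neq_ltn vw.
exists (#|K| - 3); split.
- rewrite subnK; last by lia.
  rewrite /chromatic_number; case: ex_minnP => k ck mk.
  apply/eqP; rewrite eqn_leq (clique_colorable cK ck) andbT; apply: mk.
  have [||X|c pc] := @colorK _ e sym_e irr_e f4 f5 K mK cK r1;
    try by [apply: leq_trans hK; lia|apply: ram1].
  by apply: proper_colorable pc; lia.
- by move=> u v w /ub; lia.
(* Any three vertices of [K] attain the maximum; they are sorted because only increasing triples are
   enumerated. *)
pose s := enum K.
pose t := sort (fun x y : 'I_n => x <= y) (take 3 s).
have st : size t = 3 by rewrite size_sort size_takel // -cardE; apply: leq_trans hK; lia.
have ut : uniq t by rewrite sort_uniq take_uniq // enum_uniq.
have tK x : x \in t -> x \in K by rewrite mem_sort => /mem_take; rewrite mem_enum.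
have so : sorted (fun x y : 'I_n => x <= y) t.
  by apply: sort_sorted => x y; exact: leq_total.
case: t st ut tK so => [|u [|v [|w [|]]]] //= _ ut tK /and3P[uv vw _].
have uvw : u < v < w.
  move: ut; rewrite !inE negb_or -andbA => /and4P[nuv _ nvw _].
  by rewrite !ltn_neqAle uv vw nuv nvw.
exists u, v, w; split=> //; have <- : #|common e u v w| + 3 = #|K|.
  apply/eqP; rewrite eqn_leq ub //=.
  by apply: common_lb; rewrite // tK // !inE eqxx ?orbT.
by rewrite addnK.
Qed.

(** * Composable machines *)

Section Machines.
Variable B : finType.

Definition tape := (seq (option B) * option B * seq (option B))%type.

Definition move_tape (m : move) (b : option B) (l r : seq (option B)) : tape :=
  match m with
  | MoveL => if l is x :: l' then (l', x, b :: r) else ([::], None, b :: r)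
  | MoveR => if r is x :: r' then (b :: l, x, r') else (b :: l, None, [::])
  | Stay => (l, b, r)
  end.

(** [None] is the blank. A machine halts with a value in [E], on which a successor can branch; a
    test is a machine with [E = bool]. *)
Record mach (E : Type) := Mach {
  mstate : finType;
  mstart : mstate;
  mdelta : mstate -> option B -> (mstate * option B * move) + E }.

Inductive runs E (M : mach E) : mstate M -> tape -> nat -> E -> tape -> Prop :=
| RunsExit q l a r e of mdelta q a = inr e : runs q (l, a, r) 0 e (l, a, r)
| RunsStep q l a r q' b m t e T of mdelta q a = inl (q', b, m) &
    runs q' (move_tape m b l r) t e T : runs q (l, a, r) t.+1 e T.

Definition runs0 E (M : mach E) := runs (mstart M).

Definition ret (E : Type) (e : E) : mach E :=
  Mach tt (fun _ _ => inr e).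

(** The state type of [K e] depends on [e], hence the sigma type, which is finite because [E] is.
    Handing over takes one idle [Stay] step, the [.+1] of [runs_bind]. *)
Definition bind (E : finType) (F : Type) (M : mach E) (K : E -> mach F) : mach F :=
  @Mach F (mstate M + {e : E & mstate (K e)})%type (inl (mstart M))
    (fun q a => match q with
     | inl q => match mdelta q a with
                | inl (q', b, m) => inl (inl q', b, m)
                | inr e => inl (inr (existT _ e (mstart (K e))), a, Stay)
                end
     | inr (existT e q) => match mdelta q a with
                | inl (q', b, m) => inl (inr (existT _ e q'), b, m)
                | inr f => inr f
                end
     end).

Definition loop (M : mach bool) : mach unit :=
  @Mach unit (mstate M) (mstart M)
    (fun q a => match mdelta q a with
     | inl x => inl x
     | inr true => inl (mstart M, a, Stay)
     | inr false => inr tt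
     end).

Definition while (M : mach bool) (P : mach unit) : mach unit :=
  loop (bind M (fun b => if b then bind P (fun _ => ret true) else ret false)).

Fixpoint rep (k : nat) (M : mach unit) : mach unit :=
  if k is k'.+1 then bind M (fun _ => rep k' M) else ret tt.

Lemma runs_ret E (e : E) T : runs0 (ret e) T 0 e T.
Proof. by case: T => [[l a] r]; constructor. Qed.

Lemma runs_bind (E : finType) F (M : mach E) (K : E -> mach F) T t e T1 u f T2 :
  runs0 M T t e T1 -> runs0 (K e) T1 u f T2 ->
  runs0 (bind M K) T (t + u).+1 f T2.
Proof.
move=> HM HK; rewrite /runs0 /=.
have HK' : runs (M := bind M K) (inr (existT _ e (mstart (K e)))) T1 u f T2.
  move: HK; rewrite /runs0; elim=> {u f T2 HM T1} [q l a r f H|q l a r q' b m u f T' H _ IH].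
    by constructor; rewrite /= H.
  by apply: (RunsStep (M := bind M K) _ IH); rewrite /= H.
move: HM HK'; rewrite /runs0; elim=> {t e T1 HK} [q l a r e H|q l a r q' b m t e T' H _ IH] HK.
  by apply: (RunsStep (M := bind M K) (m := Stay) (b := a) _ HK); rewrite /= H.
by rewrite addSn; apply: (RunsStep (M := bind M K) _ (IH HK)); rewrite /= H.
Qed.

Lemma runs_loop_false (M : mach bool) T t T1 :
  runs0 M T t false T1 -> runs0 (loop M) T t tt T1.
Proof.
rewrite /runs0 /=; move: (mstart M) => q0 H.
have [e He] : exists e, e = false by exists false.
rewrite -He in H; elim: H He => {t T1 T} [q l a r f H|q l a r q' b m u f T' H _ IH] E.
  by constructor; rewrite /= H E.
by apply: (RunsStep (M := loop M) _ (IH E)); rewrite /= H.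
Qed.

Lemma runs_loop_true (M : mach bool) T t T1 u T2 :
  runs0 M T t true T1 -> runs0 (loop M) T1 u tt T2 ->
  runs0 (loop M) T (t + u).+1 tt T2.
Proof.
have aux q b : runs (M := M) q T t b T1 -> b = true -> runs0 (loop M) T1 u tt T2 ->
    runs (M := loop M) q T (t + u).+1 tt T2.
  elim=> {t T1 T q b} [q l a r f H|q l a r q' b m v f T' H _ IH] E Hl.
    by apply: (RunsStep (M := loop M) (m := Stay) (b := a) _ Hl); rewrite /= H E.
  by rewrite addSn; apply: (RunsStep (M := loop M) _ (IH E Hl)); rewrite /= H.
by move=> H; apply: aux H _.
Qed.

End Machines.

(** * Translation into [TM] *)

Section Compile.
Variable C : finType.
Let B := (bool + C)%type.
Variable M : mach B unit.

Definition enc_sym (a : option B) : 'I_(#|C|).+3 :=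
  inord (match a with
         | None => 0
         | Some (inl b) => if b then 2 else 1
         | Some (inr c) => (enum_rank c).+3
         end).

Definition dec_sym (a : 'I_(#|C|).+3) : option (option B) := [pick x | enc_sym x == a].

(** A [TM] starts in state 0, whereas the rank of [mstart M] is arbitrary. State 0 is therefore an
    additional copy of the start state, to which no transition leads. *)
Definition dec_state (q : 'I_(#|mstate M|).+1) : mstate M :=
  if unlift ord0 q is Some j then enum_val j else mstart M.

Definition enc_state (q : mstate M) : 'I_(#|mstate M|).+1 := lift ord0 (enum_rank q).

Definition tm_of : TM := {|
  tm_Q := #|mstate M|;
  tm_S := #|C|;
  tm_delta := fun q a =>
    if dec_sym a is Some x then
      match mdelta (dec_state q) x with
      | inl (q', b, m) => Some (enc_state q', enc_sym b, m)
      | inr _ => None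
      end
    else None |}.

Lemma enc_symE a : enc_sym a = (match a with
         | None => 0
         | Some (inl b) => if b then 2 else 1
         | Some (inr c) => (enum_rank c).+3
         end) :> nat.
Proof.
rewrite inordK //; case: a => [[[]|c]|] //=.
by rewrite !ltnS; case: (enum_rank c) => i /=.
Qed.

Lemma enc_sym_inj : injective enc_sym.
Proof.
move=> x y /(congr1 (@nat_of_ord _)); rewrite !enc_symE.
case: x => [[[]|c]|]; case: y => [[[]|d]|] //=.
by case=> /ord_inj /enum_rank_inj ->.
Qed.

Lemma enc_symK x : dec_sym (enc_sym x) = Some x.
Proof.
rewrite /dec_sym; case: pickP => [y /eqP /enc_sym_inj -> //|/(_ x)].
by rewrite eqxx.
Qed.

Lemma enc_stateK : cancel enc_state dec_state.
Proof. by move=> q; rewrite /dec_state /enc_state liftK enum_rankK. Qed.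

Lemma enc_sym_blank : enc_sym None = blank tm_of.
Proof. by apply: ord_inj; rewrite enc_symE. Qed.

Definition enc_tape (T : tape B) (q : 'I_(#|mstate M|).+1) : config tm_of :=
  (q, map enc_sym T.1.1, enc_sym T.1.2, map enc_sym T.2).

(** [exec] recurses on the last step; [runs] is built from the first one. *)
Lemma exec_step t (c c' : config tm_of) :
  step tm_of c = Some c' -> exec tm_of t.+1 c = exec tm_of t c'.
Proof.
move=> H; elim: t => [|t IH]; first by rewrite /= H.
by rewrite [LHS]/= -/(exec tm_of t.+1 c) IH.
Qed.

Lemma exec_halted t u (c : config tm_of) :
  t <= u -> halted (exec tm_of t c) -> exec tm_of u c = exec tm_of t c.
Proof.
move=> /subnK <-; elim: (u - t) => // k IH H.
by rewrite addSn /= IH //; move/eqP: H => ->.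
Qed.

Lemma runs_exec q q' T t e T' : dec_state q' = q -> runs (M := M) q T t e T' ->
  exists q1, exec tm_of t (enc_tape T q') = enc_tape T' q1 /\
             halted (exec tm_of t (enc_tape T q')).
Proof.
move=> Hq H; elim: H q' Hq => {q T t e T'}
  [q l a r e H|q l a r q1 b m t e T H _ IH] q' Hq.
  exists q'; split=> //; rewrite /halted /=.
  by rewrite enc_symK Hq H.
have Hs : step tm_of (enc_tape (l, a, r) q') =
          Some (enc_tape (move_tape m b l r) (enc_state q1)).
  rewrite /= enc_symK Hq H; congr Some.
  by case: m {H IH} => //; [case: l => [|x l]|case: r => [|x r]];
     rewrite /enc_tape /= ?enc_sym_blank.
rewrite (exec_step _ Hs); apply: IH; exact: enc_stateK.
Qed.

Definition tape_output (T : tape B) : nat :=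
  let s := T.1.2 :: T.2 in
  let isb (x : option B) := if x is Some (inl _) then true else false in
  foldl (fun acc (b : bool) => acc.*2 + b) 0
    [seq (if x is Some (inl b) then b else false) | x <- take (find (predC isb) s) s].

Lemma output_enc T q : output (enc_tape T q) = tape_output T.
Proof.
case: T => [[l a] r].
have key (s : seq (option B)) :
    [seq nat_of_ord x == 2 | x : sym tm_of <-
       take (find (predC (is_bit tm_of)) (map enc_sym s)) (map enc_sym s)] =
    [seq (if x is Some (inl b) then b else false) | x : option B <-
       take (find (predC (fun x : option B => if x is Some (inl _) then true else false)) s) s].
  rewrite find_map -map_take -map_comp.
  have -> : find (preim enc_sym (predC (is_bit tm_of))) s = find (predC
      (fun x : option B => if x is Some (inl _) then true else false)) s.
    apply: eq_find => x /=; congr negb; rewrite /is_bit enc_symE.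
    by case: x => [[[]|c]|].
  apply: eq_map => x /=; rewrite enc_symE.
  by case: x => [[[]|c]|].
exact: (congr1 (foldl (fun acc (b : bool) => acc.*2 + b) 0) (key (a :: r))).
Qed.

Lemma init_enc w : init tm_of w =
  enc_tape (if w is b :: w' then ([::], Some (inl b), [seq Some (inl b) | b <- w'])
            else ([::], None, [::])) ord0.
Proof.
have Hb b : bit_sym tm_of b = enc_sym (Some (inl b)).
  by apply: ord_inj; rewrite enc_symE.
rewrite /init; case: w => [|b w] /=; first by rewrite /enc_tape /= enc_sym_blank.
rewrite /enc_tape /= -map_comp Hb; congr (_, _, _, _).
Qed.

Lemma tm_of_run w t u T :
  runs0 M (if w is b :: w' then ([::], Some (inl b), [seq Some (inl b) | b <- w'])
            else ([::], None, [::])) t tt T -> t <= u ->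
  halted (exec tm_of u (init tm_of w)) /\
  output (exec tm_of u (init tm_of w)) = tape_output T.
Proof.
move=> H tu; rewrite init_enc.
have [|q1 [E Hh]] := @runs_exec _ ord0 _ _ _ _ _ H.
  by rewrite /dec_state unlift_none.
by rewrite (exec_halted tu Hh) Hh E output_enc.
Qed.

End Compile.

(** * Registers on the tape *)

(** Content [None] marks an extra cell after the last bit, so that a register can take every value
    from 0 to the length of the word. The first component lets the head find its way back to the
    left end. *)
Definition cell := (bool * option bool * {ffun 'I_11 -> bool})%type.
Notation symb := (bool + cell)%type.
Notation machine := (mach symb).

Definition first (c : cell) : bool := c.1.1.
Definition content (c : cell) : option bool := c.1.2.
Definition flag (c : cell) (r : nat) : bool := c.2 (inord r).
Definition set_flag (c : cell) (r : nat) (v : bool) : cell :=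
  (c.1, [ffun x : 'I_11 => if x == r :> nat then v else c.2 x]).

Definition go_left : machine unit :=
  @Mach symb unit unit tt (fun _ a =>
    if a is Some (inr c) then if first c then inr tt else inl (tt, a, MoveL)
    else inr tt).

(** A sweep to the right by a transducer with one bit of memory, on which [g] acts together with the
    current cell. The first state component records that the end cell has been rewritten, since an
    exit cannot write. *)
Definition pass (g : bool -> cell -> bool * cell) : machine bool :=
  @Mach symb bool (bool * bool)%type (false, false) (fun q a =>
    if q.1 then inr q.2
    else if a is Some (inr c) then
      inl ((content c == None, (g q.2 c).1), Some (inr (g q.2 c).2),
           if content c == None then Stay else MoveR)
    else inr q.2).

(** The carry is the old flag of the previous cell, so the mark moves one cell to the right. *)
Definition inc (r : nat) : machine unit :=
  bind (pass (fun b c => (flag c r, set_flag c r b))) (fun _ => go_left).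
Definition copy (r s : nat) : machine unit :=
  bind (pass (fun _ c => (false, set_flag c r (flag c s)))) (fun _ => go_left).
Definition clear (r : nat) : machine unit :=
  bind (pass (fun _ c => (false, set_flag c r (first c)))) (fun _ => go_left).
Definition test (r : nat) (p : cell -> bool) : machine bool :=
  bind (pass (fun b c => (b || flag c r && p c, c)))
       (fun b => bind go_left (fun _ => ret symb b)).

(* The binary counter occupies the cells left of the first cell, least
   significant bit nearest to it. *)
Definition count_up : machine unit :=
  @Mach symb unit (option bool) None (fun q a =>
    match q, a with
    | None, _ => inl (Some false, a, MoveL)
    | Some false, Some (inl true) => inl (Some false, Some (inl false), MoveL)
    | Some false, _ => inl (Some true, Some (inl true), MoveR)
    | Some true, Some (inr _) => inr tt
    | Some true, _ => inl (Some true, a, MoveR)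
    end).

(** [output] reads from the head on, most significant bit first, so the head goes to the far end of
    the counter. The first cell, not being a bit, ends the block. *)
Definition go_output : machine unit :=
  @Mach symb unit (option bool) None (fun q a =>
    match q, a with
    | None, _ => inl (Some false, a, MoveL)
    | Some false, None => inl (Some true, a, MoveR)
    | Some false, _ => inl (Some false, a, MoveL)
    | Some true, _ => inr tt
    end).

Fixpoint bits_succ (l : seq bool) : seq bool :=
  match l with
  | [::] => [:: true]
  | true :: l' => false :: bits_succ l'
  | false :: l' => true :: l'
  end.

Definition bits (k : nat) : seq bool := iter k bits_succ [::].

Definition val_bits (l : seq bool) : nat := foldr (fun (b : bool) acc => acc.*2 + b) 0 l.

Lemma val_bitsE k : val_bits (bits k) = k.
Proof.
have H l : val_bits (bits_succ l) = (val_bits l).+1.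
  elim: l => [|[] l IH] //=; last by lia.
  by rewrite /= in IH *; rewrite IH; lia.
by elim: k => // k IH; rewrite /bits iterS H IH.
Qed.

Lemma size_bits k : size (bits k) <= k.
Proof.
have H l : size (bits_succ l) <= (size l).+1.
  by elim: l => [|[] l IH] //=.
by elim: k => // k IH; rewrite /bits iterS; apply: leq_trans (H _) _.
Qed.

Definition bit_syms (l : seq bool) : seq (option symb) := [seq Some (inl b) | b <- l].

Definition cells (f : nat -> cell) (a b : nat) : seq (option symb) :=
  [seq Some (inr (f j)) | j <- iota a b].

Lemma rev_cellsS f j : rev (cells f 0 j.+1) = Some (inr (f j)) :: rev (cells f 0 j).
Proof. by rewrite /cells -addn1 iotaD add0n map_cat rev_cat. Qed.

Lemma go_left_runs f l N j k : (forall i, first (f i) = (i == 0)) -> j + k = N ->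
  runs0 go_left (rev (cells f 0 j) ++ l, Some (inr (f j)), cells f j.+1 k) j tt
    (l, Some (inr (f 0)), cells f 1 N).
Proof.
move=> Hf; elim: j k => [|j IH] k jk.
  by rewrite -jk add0n; apply: RunsExit; rewrite /= Hf.
apply: (RunsStep (q' := tt : mstate go_left) (b := Some (inr (f j.+1))) (m := MoveL)).
  by rewrite /= Hf.
by rewrite rev_cellsS; apply: (IH k.+1); rewrite -jk addnS.
Qed.

(** [b j] is the carry on arrival at cell [j], and [f'] is the row of cells after the sweep. *)
Lemma pass_runs g f f' (b : nat -> bool) l N : b 0 = false ->
  (forall j, j <= N -> (content (f j) == None) = (j == N)) ->
  (forall j, j <= N -> g (b j) (f j) = (b j.+1, f' j)) ->
  runs0 (pass g) (l, Some (inr (f 0)), cells f 1 N) N.+1 (b N.+1)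
    (rev (cells f' 0 N) ++ l, Some (inr (f' N)), [::]).
Proof.
move=> b0 He Hg.
suff H k j : j + k = N -> runs (M := pass g) (false, b j)
    (rev (cells f' 0 j) ++ l, Some (inr (f j)), cells f j.+1 k) k.+1 (b N.+1)
    (rev (cells f' 0 N) ++ l, Some (inr (f' N)), [::]).
  by have := H N 0 (add0n N); rewrite b0.
elim: k j => [|k IH] j.
  rewrite addn0 => ->.
  apply: (RunsStep (M := pass g) (q' := (true, b N.+1))
            (b := Some (inr (f' N))) (m := Stay)).
    by rewrite /= Hg // He // eqxx.
  by apply: RunsExit.
move=> jk; have jN : j <= N by lia.
apply: (RunsStep (M := pass g) (q' := (false, b j.+1)) (b := Some (inr (f' j))) (m := MoveR)).
  by rewrite /= Hg // He //; have -> : (j == N) = false by lia.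
by have := IH j.+1; rewrite rev_cellsS addSnnS; apply.
Qed.

Lemma count_up_runs l c r : exists2 t, t <= (size l).*2 + 3 &
  runs0 count_up (bit_syms l, Some (inr c), r) t tt (bit_syms (bits_succ l), Some (inr c), r).
Proof.
(* In continuation form: [x] is the symbol that the head has just left, and the premise is the rest
   of the run, from the return to [x] over the incremented bits. *)
have H (x : option symb) R t T : 
    runs (M := count_up) (Some true) (bit_syms (bits_succ l), x, R) t tt T ->
    exists2 u, u <= (size l).*2 + 1 &
    runs (M := count_up) (Some false) (move_tape MoveL x (bit_syms l) R) (t + u) tt T.
  elim: l x R t => [|[] l IH] x R t HT.
  - exists 1 => //; rewrite addn1.
    by apply: (RunsStep (M := count_up) (q' := Some true) (b := Some (inl true)) (m := MoveR)).
  - have [|u Hu HT'] := IH (Some (inl false)) (x :: R) t.+1.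
      by apply: (RunsStep (M := count_up) (q' := Some true) (b := Some (inl false)) (m := MoveR)).
    exists u.+2; first by rewrite /=; lia.
    have -> : t + u.+2 = (t.+1 + u).+1 by lia.
    by apply: (RunsStep (M := count_up) (q' := Some false) (b := Some (inl false)) (m := MoveL)).
  - exists 1; first by lia.
    rewrite addn1.
    by apply: (RunsStep (M := count_up) (q' := Some true) (b := Some (inl true)) (m := MoveR)).
have [|u Hu HT] := H (Some (inr c)) r 0 (bit_syms (bits_succ l), Some (inr c), r).
  by apply: RunsExit.
exists u.+1; first by lia.
by apply: (RunsStep (M := count_up) (q' := Some false) (b := Some (inr c)) (m := MoveL)).
Qed.

Lemma go_output_runs l c r : exists T,
  runs0 go_output (bit_syms l, Some (inr c), r) (size l).+2 tt T /\
  tape_output T = val_bits l.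
Proof.
have H (x : option symb) R : runs (M := go_output) (Some false) (move_tape MoveL x (bit_syms l) R)
    (size l).+1 tt (move_tape MoveR None [::] (rev (bit_syms l) ++ x :: R)).
  elim: l x R => [|b l IH] x R.
  - apply: (RunsStep (M := go_output) (q' := Some true) (b := None) (m := MoveR)) => //.
    exact: (@RunsExit _ _ go_output (Some true) [:: None] x R tt erefl).
  - apply: (RunsStep (M := go_output) (q' := Some false) (b := Some (inl b)) (m := MoveL)) => //.
    by rewrite /= rev_cons cat_rcons; apply: IH.
exists (move_tape MoveR None [::] (rev (bit_syms l) ++ Some (inr c) :: r)); split.
  apply: (RunsStep (M := go_output) (q' := Some false) (b := Some (inr c)) (m := MoveL)) => //.
rewrite /bit_syms -map_rev -/(bit_syms _) /val_bits.
rewrite -(foldl_rev (fun acc (b : bool) => acc.*2 + b)).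
move: (rev l) => {H}l.
have -> : tape_output (move_tape MoveR None [::] (bit_syms l ++ Some (inr c) :: r)) =
   foldl (fun acc (b : bool) => acc.*2 + b) 0
    [seq (if x is Some (inl b) then b else false) |
      x <- take (find (predC (fun x : option symb => if x is Some (inl _) then true else false))
          (bit_syms l ++ Some (inr c) :: r)) (bit_syms l ++ Some (inr c) :: r)].
  by case: l.
congr foldl; elim: l => //= b l IH; congr cons; exact: IH.
Qed.

Definition upd (s : nat -> nat) (r v : nat) : nat -> nat :=
  fun x => if x == r then v else s x.

(** One budget for every basic operation: a sweep over [N + 1] cells and back, or a carry through a
    counter of at most [N + 3] bits. *)
Definition tau (N : nat) : nat := 2 * N + 20.

(** * A program logic with time bounds *)

Section Wp.
Variable w : seq bool.
Let N := size w.
Notation tau := (tau (size w)).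

(* Registers 0 to 10 are positions on the tape; s 11 is the binary counter. *)
Definition cell_at (s : nat -> nat) (j : nat) : cell :=
  (j == 0, if j < size w then Some (nth false w j) else None,
   [ffun x : 'I_11 => s x == j]).

(** The normal form between operations: the head on the first cell, the counter to its left.
    Programs can then be treated as acting on [s] alone. *)
Definition tape_of (s : nat -> nat) : tape symb :=
  (bit_syms (bits (s 11)), Some (inr (cell_at s 0)), cells (cell_at s) 1 (size w)).

Definition wp (t : nat) E (M : machine E) (s : nat -> nat) (Q : E -> (nat -> nat) -> Prop) :=
  exists u e s', [/\ u <= t, runs0 M (tape_of s) u e (tape_of s') & Q e s'].

Lemma wp_le t t' E (M : machine E) s Q : t <= t' -> wp t M s Q -> wp t' M s Q.
Proof. by move=> tt' [u [e [s' [ut Hu HQ]]]]; exists u, e, s'; split=> //; lia. Qed.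

Lemma wp_post t E (M : machine E) s (Q Q' : E -> (nat -> nat) -> Prop) :
  wp t M s Q' -> (forall e s', Q' e s' -> Q e s') -> wp t M s Q.
Proof. by move=> [u [e [s' [ut Hu HQ]]]] H; exists u, e, s'; split=> //; apply: H. Qed.

Lemma wp_ret E (e : E) s (Q : E -> (nat -> nat) -> Prop) : Q e s -> wp 0 (ret symb e) s Q.
Proof. by move=> HQ; exists 0, e, s; split=> //; apply: runs_ret. Qed.

Lemma wp_bind t1 t2 (E : finType) F (M : machine E) (K : E -> machine F) s Q :
  wp t1 M s (fun e s' => wp t2 (K e) s' Q) -> wp (t1 + t2).+1 (bind M K) s Q.
Proof.
move=> [u [e [s' [ut Hu [v [f [s'' [vt Hv HQ]]]]]]]].
by exists (u + v).+1, f, s''; split=> //; [lia|apply: runs_bind Hu Hv].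
Qed.

Lemma content_cell_at s j : j <= N -> (content (cell_at s j) == None) = (j == N).
Proof.
rewrite /content /= -/N => jN.
by case: ltngtP jN.
Qed.

Lemma flag_cell_at s j r : r < 11 -> flag (cell_at s j) r = (s r == j).
Proof. by move=> r11; rewrite /flag /= ffunE inordK. Qed.

Lemma set_flag_cell_at s j r v b : b = (v == j) ->
  set_flag (cell_at s j) r b = cell_at (upd s r v) j.
Proof.
move=> ->; rewrite /set_flag /cell_at /=; congr (_, _).
by apply/ffunP => x; rewrite !ffunE /upd; case: eqP.
Qed.

Lemma wp_pass_unit g s s' (b : nat -> bool) (Q : unit -> (nat -> nat) -> Prop) :
  s' 11 = s 11 -> b 0 = false ->
  (forall j, j <= N -> g (b j) (cell_at s j) = (b j.+1, cell_at s' j)) ->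
  Q tt s' -> wp tau (bind (pass g) (fun _ => go_left)) s Q.
Proof.
move=> s11 b0 Hg HQ.
exists (N.+1 + N).+1, tt, s'; split=> //; first by rewrite /tau; lia.
rewrite /tape_of s11 -/N.
apply: (@runs_bind symb bool unit _ (fun _ => go_left)).
  exact: pass_runs b0 (content_cell_at s) Hg.
by apply: (@go_left_runs _ _ N N 0) => //; rewrite addn0.
Qed.

(** [s r < N] keeps the mark from falling off the end cell, which has index [N]. *)
Lemma wp_inc r s (Q : unit -> (nat -> nat) -> Prop) : r < 11 -> s r < N ->
  Q tt (upd s r (s r).+1) -> wp tau (inc r) s Q.
Proof.
move=> r11 rN; apply: (@wp_pass_unit _ _ _ (fun j => (s r).+1 == j)) => //.
  by rewrite /upd; case: eqP => // E; rewrite -E in r11.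
by move=> j jN; rewrite flag_cell_at // eqSS; congr (_, _); apply: set_flag_cell_at.
Qed.

Lemma wp_copy r q s (Q : unit -> (nat -> nat) -> Prop) : r < 11 -> q < 11 ->
  Q tt (upd s r (s q)) -> wp tau (copy r q) s Q.
Proof.
move=> r11 q11; apply: (@wp_pass_unit _ _ _ (fun j => false)) => //.
  by rewrite /upd; case: eqP => // E; rewrite -E in r11.
by move=> j jN; rewrite flag_cell_at //; congr (_, _); apply: set_flag_cell_at.
Qed.

Lemma wp_clear r s (Q : unit -> (nat -> nat) -> Prop) : r < 11 ->
  Q tt (upd s r 0) -> wp tau (clear r) s Q.
Proof.
move=> r11; apply: (@wp_pass_unit _ _ _ (fun j => false)) => //.
  by rewrite /upd; case: eqP => // E; rewrite -E in r11.
by move=> j jN; congr (_, _); apply: set_flag_cell_at; rewrite eq_sym.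
Qed.

Lemma wp_test r p s (Q : bool -> (nat -> nat) -> Prop) : r < 11 -> s r <= N ->
  Q (p (cell_at s (s r))) s -> wp tau (test r p) s Q.
Proof.
move=> r11 rN HQ; pose b j := (s r < j) && p (cell_at s (s r)).
exists (N.+1 + (N + 0).+1).+1, (b N.+1), s; split; [by rewrite /tau; lia| |by rewrite /b ltnS rN].
apply: (@runs_bind symb bool bool _ (fun b => bind go_left (fun _ => ret symb b))).
  apply: (@pass_runs _ (cell_at s) (cell_at s) b); [by []|exact: content_cell_at|].
  move=> j jN; rewrite flag_cell_at //; congr (_, _); rewrite /b ltnS.
  by case: (ltngtP (s r) j) => [||->] //=; rewrite ?orbF.
apply: (@runs_bind symb unit bool _ (fun _ => ret symb (b N.+1))); last exact: runs_ret.
by apply: (@go_left_runs _ _ N N 0) => //; rewrite addn0.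
Qed.

Lemma wp_count_up s (Q : unit -> (nat -> nat) -> Prop) : s 11 <= N + 3 ->
  Q tt (upd s 11 (s 11).+1) -> wp tau count_up s Q.
Proof.
move=> k3 HQ.
have [t Ht HR] := count_up_runs (bits (s 11)) (cell_at s 0) (cells (cell_at s) 1 N).
exists t, tt, (upd s 11 (s 11).+1); split=> //.
  by have := size_bits (s 11); rewrite /tau; lia.
have E j : cell_at (upd s 11 (s 11).+1) j = cell_at s j.
  rewrite /cell_at; congr (_, _); apply/ffunP => x; rewrite !ffunE /upd.
  by rewrite (ltn_eqF (ltn_ord x)).
rewrite /tape_of E /cells (eq_map (g := fun j => Some (inr (cell_at s j)))) //.
by move=> j; rewrite E.
Qed.

Lemma wp_if r (p : cell -> bool) t M s (Q : unit -> (nat -> nat) -> Prop) : r < 11 -> s r <= N ->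
  (p (cell_at s (s r)) -> wp t M s Q) -> (~~ p (cell_at s (s r)) -> Q tt s) ->
  wp (tau + t).+1 (bind (test r p) (fun b => if b then M else ret symb tt)) s Q.
Proof.
move=> r11 rN H1 H2; apply: wp_bind; apply: wp_test => //.
case: ifP => [/H1 //|/negbT/H2 H].
by apply: wp_le (wp_ret H).
Qed.

(** The body runs exactly [m] times, and [m <= N] makes the budget depend on [N] only, with one more
    round for the failing test. The 5 covers the idle steps of [bind] and [loop]. *)
Lemma wp_while r (p : cell -> bool) t M m (I : nat -> (nat -> nat) -> Prop) s :
  r < 11 -> m <= N -> I 0 s ->
  (forall i s, i <= m -> I i s -> s r <= N /\ p (cell_at s (s r)) = (i < m)) ->
  (forall i s, i < m -> I i s -> wp t M s (fun _ s' => I i.+1 s')) ->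
  wp (N.+1 * (tau + t + 5)) (while (test r p) M) s (fun _ s' => I m s').
Proof.
move=> r11 mN I0 Ht Hb.
suff H d i s' : i + d = m -> I i s' ->
    wp (d.+1 * (tau + t + 5)) (while (test r p) M) s' (fun _ s' => I m s').
  by apply: wp_le (H m 0 s _ I0); rewrite ?leq_mul2r ?ltnS ?mN ?orbT.
elim: d i s' => [|d IH] i s' Ei Ii.
  have [rN pE] := Ht i s' (leq_trans (leq_addr _ _) (eq_leq Ei)) Ii.
  rewrite addn0 in Ei; rewrite Ei ltnn in pE.
  have : wp (tau + 0).+1 (bind (test r p) (fun b => if b then bind M (fun _ => ret symb true)
           else ret symb false)) s' (fun b s'' => b = false /\ I m s'').
    apply: wp_bind; apply: wp_test => //; rewrite pE; apply: wp_ret.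
    by split=> //; rewrite -Ei.
  move=> [u [e [s1 [Hu HR [Ee I1]]]]]; rewrite {}Ee in HR.
  exists u, tt, s1; split=> //; first by lia.
  exact: runs_loop_false.
have im : i < m by lia.
have [rN pE] := Ht i s' (ltnW im) Ii; rewrite im in pE.
have : wp (tau + (t + 0).+1).+1 (bind (test r p) (fun b => if b then bind M (fun _ => ret symb true)
           else ret symb false)) s' (fun b s'' => b = true /\ I i.+1 s'').
  apply: wp_bind; apply: wp_test => //; rewrite pE; apply: wp_bind.
  by apply: wp_post (Hb i s' im Ii) _ => e s1 I1; apply: wp_ret.
move=> [u [e [s1 [Hu HR [Ee I1]]]]]; rewrite {}Ee in HR.
have [|v [f [s2 [Hv HR2 I2]]]] := IH i.+1 s1 _ I1; first by lia.
exists (u + v).+1, tt, s2; split=> //; first by lia.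
by apply: runs_loop_true HR _; case: f HR2.
Qed.

End Wp.

(** * The counting program *)

(** [rN] will hold n, [rP] the square under construction, [rT] a loop counter. [rU], [rV], [rW] are
    the positions where three rows start, [rA], [rB], [rC] the reading positions in them, [rX] the
    hits of the current triple and [rM] the maximum so far. *)
Notation rN := 0 (only parsing).
Notation rP := 1 (only parsing).
Notation rT := 2 (only parsing).
Notation rU := 3 (only parsing).
Notation rV := 4 (only parsing).
Notation rW := 5 (only parsing).
Notation rA := 6 (only parsing).
Notation rB := 7 (only parsing).
Notation rC := 8 (only parsing).
Notation rX := 9 (only parsing).
Notation rM := 10 (only parsing).

Definition seqm (M P : machine unit) : machine unit := bind M (fun _ => P).
Notation "M ;; P" := (seqm M P) (at level 61, right associativity).
Definition ifm (r : nat) (p : cell -> bool) (M : machine unit) : machine unit :=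
  bind (test r p) (fun b => if b then M else ret symb tt).
Definition differs (q : nat) (c : cell) := ~~ flag c q.
Definition not_end (c : cell) := content c != None.
Definition is_one (c : cell) := content c == Some true.

Definition add_n (X : nat) : machine unit :=
  clear rT ;; while (test rT (differs rN)) (inc X ;; inc rT).

(* n is recovered from n^2 = 1 + 3 + ... + (2n - 1). *)
Definition find_root : machine unit :=
  while (test rP not_end)
    (clear rT ;; while (test rT (differs rN)) (inc rP ;; inc rP ;; inc rT) ;;
     inc rP ;; inc rN).

(** Registers are compared for equality only, so the maximum is kept up to date during the count:
    [rM] grows with [rX] exactly when both agree before the new hit. *)
Definition hit : machine unit := ifm rX (fun c => flag c rM) (inc rM) ;; inc rX.

Definition scan_step : machine unit :=
  ifm rA is_one (ifm rB is_one (ifm rC is_one hit)) ;;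
  inc rA ;; inc rB ;; inc rC ;; inc rT.

Definition scan : machine unit :=
  copy rA rU ;; copy rB rV ;; copy rC rW ;; clear rT ;; clear rX ;;
  while (test rT (differs rN)) scan_step.

(** After the last row [X] points to n * n, the end cell. *)
Definition rows (X : nat) (body : machine unit) : machine unit :=
  while (test X not_end) (body ;; add_n X).

Definition loopW : machine unit := copy rW rV ;; add_n rW ;; rows rW scan.
Definition loopV : machine unit := copy rV rU ;; add_n rV ;; rows rV loopW.

(** [rM] is a position on the tape and is converted to binary by counting up to it. The last three
    [count_up] account for the three vertices themselves. *)
Definition main : machine unit :=
  find_root ;; rows rU loopV ;; clear rT ;;
  while (test rT (differs rM)) (count_up ;; inc rT) ;;
  count_up ;; count_up ;; count_up.

Section Times.
Variable N : nat.
Notation tau := (tau N).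
(** These bounds repeat the shape of the programs term by term, so that [wp_bind] and [wp_while]
    apply by unification. *)
Definition Tadd := (tau + N.+1 * (tau + (tau + tau).+1 + 5)).+1.
Definition Troot := N.+1 * (tau + (tau + (N.+1 * (tau + (tau + (tau + tau).+1).+1 + 5) +
  (tau + tau).+1).+1).+1 + 5).
Definition Thit := ((tau + tau).+1 + tau).+1.
Definition Tstep := ((tau + (tau + (tau + Thit).+1).+1).+1 +
  (tau + (tau + (tau + tau).+1).+1).+1).+1.
Definition Tscan := (tau + (tau + (tau + (tau + (tau +
  N.+1 * (tau + Tstep + 5)).+1).+1).+1).+1).+1.
Definition Trows t := N.+1 * (tau + (t + Tadd).+1 + 5).
Definition TloopW := (tau + (Tadd + Trows Tscan).+1).+1.
Definition TloopV := (tau + (Tadd + Trows TloopW).+1).+1.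
Definition Tmain := (Troot + (Trows TloopV + (tau + (N.+1 * (tau + (tau + tau).+1 + 5) +
  (tau + (tau + tau).+1).+1).+1).+1).+1).+1.
End Times.

(** * Correctness of the counting program *)

Section Programs.
Variables (w : seq bool) (n : nat).
Hypothesis sw : size w = n * n.
Notation N := (size w).
Notation wp := (wp w).

Lemma differsE s r q : q < 11 -> differs q (cell_at w s (s r)) = (s q != s r).
Proof. by move=> q11; rewrite /differs flag_cell_at. Qed.

Lemma not_endE s r : s r <= N -> not_end (cell_at w s (s r)) = (s r < N).
Proof. by move=> rN'; rewrite /not_end content_cell_at // ltn_neqAle rN' andbT. Qed.

Lemma is_oneE s r : s r < N -> is_one (cell_at w s (s r)) = nth false w (s r).
Proof. by move=> rN'; rewrite /is_one /content /= rN'; case: (nth _ _ _). Qed.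

Lemma wp_add X s : X < 11 -> X != 0 -> X != 2 -> s X + s 0 <= N ->
  wp (Tadd N) (add_n X) s (fun _ s' => s' X = s X + s 0 /\
    forall y, y != X -> y != 2 -> s' y = s y).
Proof.
move=> X11 X0 X2 XN; apply: wp_bind; apply: wp_clear => //.
pose I i (s1 : nat -> nat) := [/\ s1 2 = i, s1 X = s X + i
  & forall y, y != X -> y != 2 -> s1 y = s y].
have := @wp_while w 2 (differs 0) (tau N + tau N).+1 (inc X ;; inc 2) (s 0) I (upd s 2 0).
move=> H; apply: wp_post (H _ _ _ _ _) _ => //; try lia.
- split; rewrite /upd ?eqxx ?(negbTE X2) ?addn0 // => y yX y2.
  by rewrite (negbTE y2).
- move=> i s1 im [s12 s1X s1y]; split; first by lia.
  by rewrite differsE // s12 (s1y 0) 1?eq_sym //; lia.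
- move=> i s1 im [s12 s1X s1y]; apply: wp_bind; apply: wp_inc => //; first by lia.
  have E2 : upd s1 X (s1 X).+1 2 = i by rewrite /upd eq_sym (negbTE X2).
  apply: wp_inc => //; first by rewrite E2; lia.
  rewrite E2; split=> //.
  + by rewrite /upd (negbTE X2) eqxx s1X addnS.
  + by move=> y yX y2; rewrite /upd (negbTE y2) (negbTE yX) s1y.
- by move=> e s1 [].
Qed.

Lemma wp_find_root s : (forall y, s y = 0) ->
  wp (Troot N) find_root s (fun _ s' => s' 0 = n /\ forall y, 2 < y -> s' y = 0).
Proof.
move=> s0.
pose I i (s1 : nat -> nat) := [/\ s1 1 = i * i, s1 0 = i & forall y, 2 < y -> s1 y = 0].
apply: wp_post (@wp_while w 1 not_end _ _ n I s _ _ _ _ _) _ => //.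
- by rewrite sw; nia.
- move=> i s1 im [s11 s10 s1y].
  have h : s1 1 <= N by rewrite s11 sw; nia.
  by split=> //; rewrite not_endE // s11 sw; nia.
- move=> i s1 im [s11 s10 s1y].
  apply: wp_bind; apply: wp_clear => //.
  pose J j (s2 : nat -> nat) := [/\ s2 1 = i * i + 2 * j, s2 2 = j, s2 0 = i
    & forall y, 2 < y -> s2 y = 0].
  apply: wp_bind.
  apply: wp_post (@wp_while w 2 (differs 0) _ _ i J (upd s1 2 0) _ _ _ _ _) _ => //.
  + by rewrite sw; nia.
  + split; rewrite /upd //=; first by rewrite s11; lia.
    by case=> [|[|[|y]]] // _; apply: s1y.
  + move=> j s2 ji [s21 s22 s20 s2y]; split; first by rewrite s22 sw; nia.
    by rewrite differsE // s22 s20; lia.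
  + move=> j s2 ji [s21 s22 s20 s2y].
    apply: wp_bind; apply: wp_inc => //; first by rewrite s21 sw; nia.
    apply: wp_bind; apply: wp_inc => //; first by rewrite /upd /= s21 sw; nia.
    apply: wp_inc => //; first by rewrite /upd /= s22 sw; nia.
    split; rewrite /upd //=; try lia.
    by case=> [|[|[|y]]] // _; apply: s2y.
  + move=> _ s2 [s21 s22 s20 s2y].
    apply: wp_bind; apply: wp_inc => //; first by rewrite s21 sw; nia.
    apply: wp_inc => //; first by rewrite /upd /= s20 sw; nia.
    split; rewrite /upd //=; try lia.
    by case=> [|[|[|y]]] // _; apply: s2y.
- by move=> _ s1 [].
Qed.

Definition hits (u v x j : nat) : bool :=
  [&& nth false w (u * n + j), nth false w (v * n + j) & nth false w (x * n + j)].
Definition cnt (u v x i : nat) : nat := count (hits u v x) (iota 0 i).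

Lemma cntS u v x i : cnt u v x i.+1 = cnt u v x i + hits u v x i.
Proof. by rewrite /cnt -addn1 iotaD count_cat /= addn0 add0n. Qed.

Lemma cnt_le u v x i : cnt u v x i <= i.
Proof. by rewrite -{2}(size_iota 0 i); apply: count_size. Qed.

(** [m] is the maximum over the earlier triples. Passing from [c] to [c.+1] changes [maxn m c]
    exactly when it equals [c], which is the condition tested. *)
Lemma wp_hit s m c : s 9 = c -> s 10 = maxn m c -> c < N -> s 10 <= N ->
  wp (Thit N) hit s (fun _ s' => [/\ s' 9 = c.+1, s' 10 = maxn m c.+1 &
    forall y, y != 9 -> y != 10 -> s' y = s y]).
Proof.
move=> s9 s10 cN mN; apply: wp_bind; apply: wp_if => //; first by lia.
- rewrite flag_cell_at // s9 s10 => /eqP E; apply: wp_inc => //; first by lia.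
  apply: wp_inc; rewrite /upd //=; first by lia.
  split=> //=; try lia.
  by move=> y /negbTE-> /negbTE->.
- rewrite flag_cell_at // s9 s10 => E; apply: wp_inc; rewrite /upd //=; first by lia.
  split=> //=; try lia.
  by move=> y /negbTE->.
Qed.

Lemma wp_scan s u v x : u < n -> v < n -> x < n ->
  s 0 = n -> s 3 = u * n -> s 4 = v * n -> s 5 = x * n -> s 10 <= N ->
  wp (Tscan N) scan s (fun _ s' => s' 10 = maxn (s 10) (cnt u v x n) /\
    forall y, y \in [:: 0; 3; 4; 5; 11] -> s' y = s y).
Proof.
move=> un vn xn s0 s3 s4 s5 mN.
apply: wp_bind; apply: wp_copy => //; apply: wp_bind; apply: wp_copy => //.
apply: wp_bind; apply: wp_copy => //; apply: wp_bind; apply: wp_clear => //.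
apply: wp_bind; apply: wp_clear => //.
set s' := upd _ 9 0.
pose I i (s1 : nat -> nat) := [/\ [/\ s1 6 = u * n + i, s1 7 = v * n + i & s1 8 = x * n + i],
  s1 2 = i, s1 9 = cnt u v x i, s1 10 = maxn (s 10) (cnt u v x i)
  & forall y, y \in [:: 0; 3; 4; 5; 11] -> s1 y = s y].
apply: wp_post (@wp_while w 2 (differs 0) _ _ n I s' _ _ _ _ _) _ => //.
- by rewrite sw; nia.
- split; rewrite /s' /upd //=; first by rewrite s3 s4 s5 !addn0.
  by move=> y; rewrite !inE => /orP[|/orP[|/orP[|/orP[|]]]] /eqP->.
- move=> i s1 im [_ s12 _ _ s1y]; split; first by rewrite s12 sw; nia.
  by rewrite differsE // s12 s1y // s0; lia.
- move=> i s1 im [[s16 s17 s18] s12 s19 s110 s1y].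
  have [h6 h7 h8] : [/\ s1 6 < N, s1 7 < N & s1 8 < N] by rewrite s16 s17 s18 sw; split; nia.
  have nN : n <= N by rewrite sw; nia.
  have ci := cnt_le u v x i.
  (* [Q] holds after column [i] is tested and before the reading positions advance; [Q0] serves all
     three ways of missing a hit. *)
  pose Q (s2 : nat -> nat) := [/\ s2 9 = cnt u v x i.+1, s2 10 = maxn (s 10) (cnt u v x i.+1)
    & forall y, y != 9 -> y != 10 -> s2 y = s1 y].
  have Q0 : ~~ hits u v x i -> Q s1 by move=> h; split=> //; rewrite cntS (negbTE h) addn0.
  apply: wp_bind; apply: (@wp_post _ _ _ _ _ _ (fun _ => Q)).
  + apply: wp_if; rewrite ?is_oneE ?(ltnW h6) //; last first.
      by move=> h; apply: Q0; apply: contra h; rewrite s16 => /and3P[].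
    rewrite s16 => b6; apply: wp_if; rewrite ?is_oneE ?(ltnW h7) //; last first.
      by move=> h; apply: Q0; apply: contra h; rewrite s17 => /and3P[].
    rewrite s17 => b7; apply: wp_if; rewrite ?is_oneE ?(ltnW h8) //; last first.
      by move=> h; apply: Q0; apply: contra h; rewrite s18 => /and3P[].
    rewrite s18 => b8.
    apply: wp_post (@wp_hit s1 (s 10) (cnt u v x i) s19 s110 _ _) _; try lia.
    move=> _ s2 [a b c]; split=> //; rewrite cntS /hits b6 b7 b8 addn1 //.
  + move=> _ s2 [s29 s210 s2y].
    have [e6 e7 e8 e2] : [/\ s2 6 = s1 6, s2 7 = s1 7, s2 8 = s1 8 & s2 2 = s1 2].
      by split; apply: s2y.
    apply: wp_bind; apply: wp_inc; rewrite /upd //= ?e6 //.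
    apply: wp_bind; apply: wp_inc; rewrite /upd //= ?e7 //.
    apply: wp_bind; apply: wp_inc; rewrite /upd //= ?e8 //.
    apply: wp_inc; rewrite /upd //= ?e2 //; first by lia.
    split=> //=.
    * by split; lia.
    * by lia.
    * by move=> y yin; rewrite -s1y //; move: yin;
        rewrite !inE => /orP[|/orP[|/orP[|/orP[|]]]] /eqP-> /=; apply: s2y.
- by move=> _ s1 [_ _ _ -> H].
Qed.

(** [J i] describes the state when the rows from [i0] up to, but excluding, [i] are done. By the
    last premise it survives [add_n], which alters only [X] and [rT]. *)
Lemma wp_rows X t body (J : nat -> (nat -> nat) -> Prop) s i0 :
  X < 11 -> X != 0 -> X != 2 -> i0 <= n -> s 0 = n -> s X = i0 * n -> J i0 s ->
  (forall i s1, i0 <= i < n -> s1 0 = n -> s1 X = i * n -> J i s1 ->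
    wp t body s1 (fun _ s2 => [/\ s2 0 = n, s2 X = i * n & J i.+1 s2])) ->
  (forall i s1 s2, (forall y, y != X -> y != 2 -> s2 y = s1 y) -> J i s1 -> J i s2) ->
  wp (Trows N t) (rows X body) s (fun _ s' => s' 0 = n /\ J n s').
Proof.
move=> X11 X0 X2 i0n s0 sX J0 Hb Hf.
pose I i (s1 : nat -> nat) := [/\ s1 0 = n, s1 X = (i0 + i) * n & J (i0 + i) s1].
apply: wp_post (@wp_while w X not_end _ _ (n - i0) I s _ _ _ _ _) _ => //.
- by rewrite sw; nia.
- by split; rewrite ?addn0.
- move=> i s1 im [s10 s1X J1].
  have h : s1 X <= N by rewrite s1X sw leq_mul2r; lia.
  by split=> //; rewrite not_endE // s1X sw ltn_mul2r; lia.
- move=> i s1 im [s10 s1X J1]; apply: wp_bind.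
  apply: wp_post (Hb (i0 + i) s1 _ s10 s1X J1) _; first by lia.
  move=> _ s2 [s20 s2X J2].
  have := @wp_add X s2 X11 X0 X2; rewrite s20 s2X -mulSnr sw leq_mul2r => H.
  apply: wp_post (H _) _; first by lia.
  move=> _ s3 [s3X s3y]; split.
  + by rewrite s3y // eq_sym.
  + by rewrite addnS.
  + by rewrite addnS; apply: Hf J2.
- by move=> _ s1 [s10 _]; rewrite subnKC.
Qed.

(** A bound known in advance keeps [rM] on the tape. The loops then only have to maintain [rM <= mu]
    and lower bounds by the counts seen; a triple attaining [mu] gives equality in the end. *)
Variable mu : nat.
Hypothesis muN : mu <= N.
Hypothesis cnt_mu : forall u v x, u < v < x -> x < n -> cnt u v x n <= mu.

Lemma wp_loopW s u v : u < v -> v < n ->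
  s 0 = n -> s 3 = u * n -> s 4 = v * n -> s 10 <= mu ->
  wp (TloopW N) loopW s (fun _ s' => [/\ [/\ s' 0 = n, s' 3 = u * n, s' 4 = v * n & s' 11 = s 11],
    s 10 <= s' 10 <= mu & forall x, v < x < n -> cnt u v x n <= s' 10]).
Proof.
move=> uv vn s0 s3 s4 mmu; have un := ltn_trans uv vn.
apply: wp_bind; apply: wp_copy => //; apply: wp_bind.
apply: wp_post (@wp_add 5 _ _ _ _ _) _; rewrite /upd //=.
  by rewrite s4 s0 -mulSnr sw leq_mul2r vn orbT.
move=> _ s1 [s15 s1y].
pose J i (s2 : nat -> nat) := [/\ [/\ s2 3 = u * n, s2 4 = v * n & s2 11 = s 11],
    s 10 <= s2 10 <= mu & forall x, v < x < i -> cnt u v x n <= s2 10].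
apply: wp_post (@wp_rows 5 _ _ J s1 v.+1 _ _ _ _ _ _ _ _ _) _ => //.
- by rewrite s1y.
- by rewrite s15 s4 s0 mulSnr.
- by split; rewrite ?s1y //=; [lia|move=> x; lia].
- move=> i s2 /andP[vi im] s20 s25 [[s23 s24 s211] s210 Hx].
  apply: wp_post (@wp_scan s2 u v i _ _ _ _ _ _ _ _) _ => //; first by lia.
  move=> _ s3' [h10 hy].
  have [e0 e3 e4 e5] := And4 (hy 0 isT) (hy 3 isT) (hy 4 isT) (hy 5 isT).
  rewrite e0 e5; split=> //; split; rewrite ?e3 ?e4 ?(hy 11) //.
  + by rewrite h10; have := @cnt_mu u v i; lia.
  + move=> x /andP[vx xi]; rewrite h10 leq_max.
    move: xi; rewrite ltnS leq_eqVlt => /orP[/eqP->|xi]; first by rewrite leqnn orbT.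
    by rewrite Hx ?vx.
- by move=> i s2 s3' H [[a b c] d e]; split; rewrite ?H.
- by move=> _ s2 [h0 [[h3 h4 h11] h10 Hx]].
Qed.

Lemma wp_loopV s u : u < n -> s 0 = n -> s 3 = u * n -> s 10 <= mu ->
  wp (TloopV N) loopV s (fun _ s' => [/\ [/\ s' 0 = n, s' 3 = u * n & s' 11 = s 11],
    s 10 <= s' 10 <= mu & forall v x, u < v < x -> x < n -> cnt u v x n <= s' 10]).
Proof.
move=> un s0 s3 mmu.
apply: wp_bind; apply: wp_copy => //; apply: wp_bind.
apply: wp_post (@wp_add 4 _ _ _ _ _) _; rewrite /upd //=.
  by rewrite s3 s0 -mulSnr sw leq_mul2r un orbT.
move=> _ s1 [s14 s1y].
pose J i (s2 : nat -> nat) := [/\ s2 3 = u * n /\ s2 11 = s 11,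
    s 10 <= s2 10 <= mu & forall v x, u < v < x -> v < i -> x < n -> cnt u v x n <= s2 10].
apply: wp_post (@wp_rows 4 _ _ J s1 u.+1 _ _ _ _ _ _ _ _ _) _ => //.
- by rewrite s1y.
- by rewrite s14 s3 s0 mulSnr.
- by split; rewrite ?s1y //=; [lia|move=> v x; lia].
- move=> i s2 /andP[ui im] s20 s24 [[s23 s211] s210 Hx].
  apply: wp_post (@wp_loopW s2 u i _ _ _ _ _ _) _ => //; first by lia.
  move=> _ s3' [[h0 h3 h4 h11] h10 hy]; split=> //; split; rewrite ?h11 //; first by lia.
  move=> v x uvx vi xn; move: vi; rewrite ltnS leq_eqVlt => /orP[/eqP Ev|vi]; last first.
    by apply: leq_trans (Hx v x uvx vi xn) _; lia.
  by rewrite Ev; apply: hy; rewrite -Ev xn andbT; case/andP: uvx.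
- by move=> i s2 s3' H [[a b] d e]; split; rewrite ?H.
- move=> _ s2 [h0 [[h3 h11] h10 Hx]]; split=> // v x uvx xn; apply: Hx => //; lia.
Qed.

Lemma wp_main s u v x : u < v < x -> x < n -> cnt u v x n = mu -> (forall y, s y = 0) ->
  wp (Tmain N) main s (fun _ s' => s' 11 = mu + 3).
Proof.
move=> uvx xn Emu s0; apply: wp_bind.
apply: wp_post (wp_find_root s0) _ => _ s1 [s10 s1y]; apply: wp_bind.
pose J i (s2 : nat -> nat) := [/\ s2 11 = 0, s2 10 <= mu &
  forall u v x, u < i -> u < v < x -> x < n -> cnt u v x n <= s2 10].
apply: wp_post (@wp_rows 3 _ _ J s1 0 _ _ _ _ _ _ _ _ _) _ => //.
- by rewrite s1y.
- by split; rewrite ?s1y.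
- move=> i s2 /andP[_ im] s20 s23 [s211 s210 Hx].
  apply: wp_post (@wp_loopV s2 i _ _ _ _) _ => //.
  move=> _ s3 [[h0 h3 h11] h10 hy]; split=> //; split; rewrite ?h11 //; first by lia.
  move=> u' v' x' ui uvx' xn'; move: ui; rewrite ltnS leq_eqVlt => /orP[/eqP Eu|ui]; last first.
    by apply: leq_trans (Hx u' v' x' ui uvx' xn') _; lia.
  by rewrite Eu; apply: hy; rewrite -?Eu.
- by move=> i s2 s3 H [a b c]; split; rewrite ?H.
move=> _ s2 [_ [s211 s210 Hx]].
have {Hx}s210' : s2 10 = mu.
  by apply/eqP; rewrite eqn_leq s210 -Emu Hx //; lia.
apply: wp_bind; apply: wp_clear => //.
move: s210' => {}s210; pose I i (s3 : nat -> nat) := [/\ s3 11 = i, s3 2 = i & s3 10 = mu].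
apply: wp_bind.
apply: wp_post (@wp_while w 2 (differs 10) _ _ mu I (upd s2 2 0) _ _ _ _ _) _ => //.
- move=> i s3 im [a b c]; split; first by lia.
  by rewrite differsE // b c; lia.
- move=> i s3 im [a b c]; apply: wp_bind; apply: wp_count_up; first by lia.
  by apply: wp_inc; rewrite /upd //=; [lia|split=> //=; lia].
move=> _ s3 [a b c]; apply: wp_bind; apply: wp_count_up; first by lia.
apply: wp_bind; apply: wp_count_up; rewrite /upd /=; first by lia.
by apply: wp_count_up; rewrite /upd /=; lia.
Qed.

End Programs.

(** * The solver *)

(** The sweep that turns bits into cells also appends the end cell and sets all registers to 0, by
    raising every flag on the first cell, recognised by [f]. Remembering only words of length at
    most [L] keeps the states finite. *)
Definition read_pass (L : nat) : machine (option {bseq L of bool}) :=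
  @Mach symb _ (bool * bool * option {bseq L of bool})%type (false, true, insub [::])
    (fun q a => let: (d, f, o) := q in
      if d then inr o else
      match a with
      | Some (inl b) => inl ((false, false, obind (fun v : {bseq L of bool} => insub (rcons v b)) o),
                             Some (inr (f, Some b, [ffun _ => f])), MoveR)
      | None => inl ((true, false, o), Some (inr (f, None, [ffun _ => f])), Stay)
      | Some (inr _) => inr o
      end).

(* The word is returned only if its length is at most L. *)
Definition read_input (L : nat) : machine (option {bseq L of bool}) :=
  bind (read_pass L) (fun o => bind go_left (fun _ => ret symb o)).

Definition input_tape (w : seq bool) : tape symb :=
  if w is b :: w' then ([::], Some (inl b), [seq Some (inl b) | b <- w'])
  else ([::], None, [::]).

Lemma read_pass_runs L w :
  runs0 (read_pass L) (input_tape w) (size w).+1 (insub w)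
    (rev (cells (cell_at w (fun _ => 0)) 0 (size w)) ++ [::],
     Some (inr (cell_at w (fun _ => 0) (size w))), [::]).
Proof.
set f := cell_at w _.
have fE j o : (if j < size w then Some (nth false w j) else None) = o ->
    f j = (j == 0, o, [ffun _ => j == 0]).
  by move=> <-; rewrite /f /cell_at; congr (_, _); apply/ffunP => x; rewrite !ffunE eq_sym.
suff H v p : p ++ v = w -> runs (M := read_pass L) (false, p == [::], insub p)
    (rev (cells f 0 (size p)) ++ [::], head None (bit_syms v), behead (bit_syms v))
    (size v).+1 (insub w)
    (rev (cells f 0 (size w)) ++ [::], Some (inr (f (size w))), [::]).
  have E v : input_tape v = ([::], head None (bit_syms v), behead (bit_syms v)) by case: v.
  by have := H w [::] erefl; rewrite /runs0 E eqxx.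
elim: v p => [|b v IH] p Ew.
  have Ep : p = w by rewrite -Ew cats0.
  apply: (RunsStep (M := read_pass L) (q' := (true, false, insub p))
            (b := Some (inr (f (size w)))) (m := Stay)).
    by rewrite (fE _ None) ?ltnn // size_eq0 -Ep.
  by rewrite Ep; apply: RunsExit.
apply: (RunsStep (M := read_pass L) (q' := (false, false, insub (rcons p b)))
            (b := Some (inr (f (size p)))) (m := MoveR)).
  rewrite (fE _ (Some b)); last first.
    by rewrite -Ew size_cat /= -[X in X < _]addn0 ltn_add2l nth_cat ltnn subnn.
  rewrite size_eq0 /=; congr (inl (_, _, _)); congr (_, _).
  case: insubP => [u _ /= -> //|/= np].
  by rewrite insubN //= size_rcons; apply: contra np; apply: ltnW.
have := IH (rcons p b); rewrite cat_rcons => /(_ Ew).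
rewrite size_rcons rev_cellsS.
have -> : (rcons p b == [::]) = false by case: (p).
by case: v {IH Ew}.
Qed.

Lemma read_input_runs L w : runs0 (read_input L) (input_tape w)
  ((size w).+1 + (size w + 0).+1).+1 (insub w) (tape_of w (fun _ => 0)).
Proof.
apply: (@runs_bind symb _ _ _ (fun o => bind go_left (fun _ => ret symb o))).
  exact: read_pass_runs.
apply: (@runs_bind symb unit _ _ (fun _ => ret symb _)); last exact: runs_ret.
by apply: (@go_left_runs _ _ (size w) (size w) 0) => //; rewrite addn0.
Qed.

(** This value is not computed by the machine: for each short word it is built into [solver] as a
    number of [count_up] steps. *)
Definition chi_mat (n : nat) (w : seq bool) : nat :=
  find (colorable (fun i j : 'I_n => nth false w (i * n + j))) (iota 0 n.+1).

Definition chi_word (w : seq bool) : nat :=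
  chi_mat (find (fun k => k * k == size w) (iota 0 (size w).+1)) w.

Definition solver (L : nat) : machine unit :=
  bind (read_input L) (fun o =>
    bind (if o is Some v then rep (chi_word v) count_up else main) (fun _ => go_output)).

Lemma size_encode n (e : rel 'I_n) : size (encode e) = n * n.
Proof. by rewrite /encode size_allpairs size_enum_ord. Qed.

Lemma nth_encode n (e : rel 'I_n) (i j : 'I_n) : nth false (encode e) (i * n + j) = e i j.
Proof.
have H (s t : seq 'I_n) a b : a < size s -> b < size t ->
    nth false [seq e x y | x <- s, y <- t] (a * size t + b) = e (nth i s a) (nth i t b).
  elim: s a => // x s IH [|a] /= as' bt; rewrite nth_cat size_map.
    by rewrite mul0n add0n bt (nth_map i).
  by rewrite mulSn -addnA ltnNge leq_addr addKn IH.
have := H (enum 'I_n) (enum 'I_n) i j; rewrite size_enum_ord !nth_ord_enum.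
by apply.
Qed.

Lemma find_first (p : pred nat) m k : p k -> k < m -> (forall i, i < k -> ~~ p i) ->
  find p (iota 0 m) = k.
Proof.
move=> pk km Hk.
have hs : has p (iota 0 m) by apply/hasP; exists k; rewrite ?mem_iota.
have fm : find p (iota 0 m) < m by rewrite has_find size_iota in hs.
have pf := nth_find 0 hs; rewrite nth_iota // add0n in pf.
apply/eqP; rewrite eqn_leq; apply/andP; split; rewrite leqNgt; apply/negP => h.
  by have := before_find 0 h; rewrite nth_iota // add0n pk.
by have := Hk _ h; rewrite pf.
Qed.

Lemma colorable_eq n (e e' : rel 'I_n) k : (forall i j, e i j = e' i j) ->
  colorable e k = colorable e' k.
Proof.
move=> H; apply: eq_existsb => f; apply: eq_forallb => x; apply: eq_forallb => y.
by rewrite H.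
Qed.

Lemma chi_wordE n (e : rel 'I_n) (irr_e : irreflexive e) :
  chi_word (encode e) = chromatic_number irr_e.
Proof.
rewrite /chi_word size_encode (@find_first _ _ n) ?eqxx //; last first.
- by move=> i im; apply/eqP; nia.
- by rewrite ltnS; nia.
rewrite /chi_mat /chromatic_number; case: ex_minnP => k ck mk.
have E i : colorable (fun i j : 'I_n => nth false (encode e) (i * n + j)) i = colorable e i.
  by apply: colorable_eq => x y; apply: nth_encode.
apply: find_first; first by rewrite E.
  rewrite ltnS; apply: mk.
  apply/existsP; exists [ffun x => x]; apply/forallP => x; apply/forallP => y.
  apply/implyP => exy; rewrite !ffunE; apply: contraTneq exy => ->.
  by rewrite irr_e.
by move=> i ik; rewrite E; apply/negP => /mk; rewrite leqNgt ik.
Qed.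

Lemma cnt_common n (e : rel 'I_n) (u v x : 'I_n) :
  cnt (encode e) n u v x n = #|common e u v x|.
Proof.
rewrite /cnt cardE /enum_mem size_filter -val_enum_ord count_map.
rewrite enumT; apply: eq_count => j /=; rewrite /hits !nth_encode.
by rewrite !inE.
Qed.

Lemma rep_count_up_runs k m c r : exists2 t, t <= k * (2 * (m + k) + 4) &
  runs0 (rep k count_up) (bit_syms (bits m), Some (inr c), r) t tt
    (bit_syms (bits (m + k)), Some (inr c), r).
Proof.
elim: k m => [|k IH] m; first by exists 0; rewrite ?addn0 //; apply: runs_ret.
have [t Ht HR] := count_up_runs (bits m) c r.
have [u Hu HR2] := IH m.+1; exists (t + u).+1.
  have := size_bits m.
  have -> : m + k.+1 = m.+1 + k by rewrite addnS.
  rewrite mulSn; lia.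
rewrite -addSnnS; apply: (@runs_bind symb unit unit _ (fun _ => rep k count_up)) HR2.
exact: HR.
Qed.

(** * Polynomial time bounds *)

Definition poly (T : nat -> nat) := exists c d, forall N, T N <= c * N.+1 ^ d.

Lemma poly_add T T' : poly T -> poly T' -> poly (fun N => T N + T' N).
Proof.
move=> [c [d H]] [c' [d' H']]; exists (c + c'), (d + d') => N.
rewrite mulnDl leq_add //.
  by apply: leq_trans (H N) _; rewrite leq_mul2l leq_pexp2l ?orbT ?leq_addr.
by apply: leq_trans (H' N) _; rewrite leq_mul2l leq_pexp2l ?orbT ?leq_addl.
Qed.

Lemma poly_mul T T' : poly T -> poly T' -> poly (fun N => T N * T' N).
Proof.
move=> [c [d H]] [c' [d' H']]; exists (c * c'), (d + d') => N.
by rewrite expnD mulnACA leq_mul.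
Qed.

Lemma poly_const k : poly (fun _ => k).
Proof. by exists k, 0 => N; rewrite expn0 muln1. Qed.

Lemma poly_id : poly id.
Proof. by exists 1, 1 => N; rewrite mul1n expn1. Qed.

Lemma poly_succ T : poly T -> poly (fun N => (T N).+1).
Proof.
move=> /(poly_add (poly_const 1)) [c [d H]]; exists c, d => N; exact: H.
Qed.

Ltac poly_auto := repeat first [exact: poly_const | exact: poly_id | apply: poly_succ
  | apply: poly_add | apply: poly_mul].

Lemma poly_tau : poly tau.
Proof. by rewrite /tau; poly_auto. Qed.
Lemma poly_Tadd : poly Tadd.
Proof. by rewrite /Tadd; poly_auto; apply: poly_tau. Qed.
Lemma poly_Troot : poly Troot.
Proof. by rewrite /Troot; poly_auto; apply: poly_tau. Qed.
Lemma poly_Tscan : poly Tscan.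
Proof. by rewrite /Tscan /Tstep /Thit; poly_auto; apply: poly_tau. Qed.
Lemma poly_Trows T : poly T -> poly (fun N => Trows N (T N)).
Proof. by move=> pT; rewrite /Trows; poly_auto. Qed.
Lemma poly_TloopW : poly TloopW.
Proof.
rewrite /TloopW; apply: poly_succ; apply: poly_add; first exact: poly_tau.
by apply: poly_succ; apply: poly_add; [apply: poly_Tadd|apply: poly_Trows poly_Tscan].
Qed.
Lemma poly_TloopV : poly TloopV.
Proof.
rewrite /TloopV; apply: poly_succ; apply: poly_add; first exact: poly_tau.
by apply: poly_succ; apply: poly_add; [apply: poly_Tadd|apply: poly_Trows poly_TloopW].
Qed.
Lemma poly_Tmain : poly Tmain.
Proof.
rewrite /Tmain; apply: poly_succ; apply: poly_add; first exact: poly_Troot.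
apply: poly_succ; apply: poly_add; first exact: poly_Trows poly_TloopV.
by poly_auto; apply: poly_tau.
Qed.

Lemma chromatic_number_le n (e : rel 'I_n) (irr_e : irreflexive e) : chromatic_number irr_e <= n.
Proof.
rewrite /chromatic_number; case: ex_minnP => k _; apply.
apply/existsP; exists [ffun x => x]; apply/forallP => x; apply/forallP => y.
apply/implyP => exy; rewrite !ffunE; apply: contraTneq exy => ->.
by rewrite irr_e.
Qed.

(** The sum covers both branches: [Tmain] for large inputs, [N * (2 * N + 4)] for counting up to a
    stored answer, the rest for reading and output. *)
Definition Ttotal (N : nat) : nat := Tmain N + (N * (2 * N + 4) + (3 * N + 20)).

Lemma poly_Ttotal : poly Ttotal.
Proof. by apply: poly_add; [apply: poly_Tmain|poly_auto]. Qed.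

Lemma solver_runs L w k t s : insub w = s :> option {bseq L of bool} -> k <= size w + 3 ->
  (exists c r, runs0 (if s is Some v then rep (chi_word v) count_up else main)
     (tape_of w (fun _ => 0)) t tt (bit_syms (bits k), Some (inr c), r)) ->
  exists u T, [/\ u <= t + (3 * size w + 12), runs0 (solver L) (input_tape w) u tt T
     & tape_output T = k].
Proof.
move=> Es kN [c [r HR]]; have [T [HT HO]] := go_output_runs (bits k) c r.
exists (((size w).+1 + (size w + 0).+1).+1 + (t + (size (bits k)).+2).+1).+1, T.
split; last by rewrite HO val_bitsE.
  by have := size_bits k; lia.
have := read_input_runs L w; rewrite Es => HI.
apply: (runs_bind HI).
exact: runs_bind HR HT.
Qed.

Theorem theorem3 :
  exists (M : TM) (c d : nat),
    forall (n : nat) (e : rel 'I_n) (sym_e : symmetric e) (irr_e : irreflexive e),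
      in_class e ->
      let w := encode e in
      let cfg := exec M (c * (size w).+1 ^ d) (init M w) in
      halted cfg /\ output cfg = chromatic_number irr_e.
Proof.
have [N0 HN0] := chromatic_number_common.
have [c [d Hcd]] := poly_Ttotal.
(* The word of a graph on n vertices has length n * n, so a word longer than [N0 * N0] comes from at
   least [N0] vertices. *)
exists (tm_of (solver (N0 * N0))), c, d => n e sym_e irr_e class_e w cfg.
have sw : size w = n * n by apply: size_encode.
have nw : n <= size w by rewrite sw; nia.
have chi_n := chromatic_number_le irr_e.
suff [u [T [Hu HR HO]]] : exists u T, [/\ u <= Ttotal (size w),
    runs0 (solver (N0 * N0)) (input_tape w) u tt T & tape_output T = chromatic_number irr_e].
  by rewrite -HO; apply: tm_of_run HR _; apply: leq_trans Hu (Hcd _).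
case Es: (insub w : option {bseq (N0 * N0) of bool}) => [v|].
  have Ev : v = w :> seq bool by case: insubP Es => // x _ <- [->].
  have [t Ht HR] := rep_count_up_runs (chromatic_number irr_e) 0 (cell_at w (fun _ => 0) 0)
    (cells (cell_at w (fun _ => 0)) 1 (size w)).
  have [||u [T [Hu HT HO]]] := @solver_runs _ w (chromatic_number irr_e) t _ Es.
  - by lia.
  - by rewrite Ev chi_wordE; exists (cell_at w (fun _ => 0) 0),
      (cells (cell_at w (fun _ => 0)) 1 (size w)).
  - exists u, T; split=> //; apply: leq_trans Hu _; rewrite /Ttotal.
    have : t <= size w * (2 * size w + 4).
      by apply: leq_trans Ht _; apply: leq_mul; lia.
    lia.
have N0n : N0 <= n.
  have : ~~ (size w <= N0 * N0) by case: insubP Es.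
  by rewrite sw; nia.
have [mu [Emu ub [a [b [x [abx Ex]]]]]] := HN0 n e sym_e irr_e class_e N0n.
have cn (i j k : nat) : i < j < k -> k < n -> cnt w n i j k n <= mu.
  move=> ijk kn; have [i_n jn] : i < n /\ j < n by lia.
  by have := ub (Ordinal i_n) (Ordinal jn) (Ordinal kn) ijk; rewrite -cnt_common.
(* [mu + 3] is the chromatic number, hence at most n. *)
have mun : mu <= size w by lia.
have [|t [[] [s' [Ht HR Es']]]] :=
  @wp_main w n sw mu mun cn (fun _ => 0) a b x abx (ltn_ord x) _ (fun _ => erefl).
  by rewrite cnt_common.
have [||u [T [Hu HT HO]]] := @solver_runs _ w (chromatic_number irr_e) t _ Es.
- by lia.
- by rewrite Emu -Es'; exists (cell_at w s' 0), (cells (cell_at w s') 1 (size w)).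
- by exists u, T; split=> //; apply: leq_trans Hu _; rewrite /Ttotal; lia.
Qed.
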